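(* For every $n\in\mathbb{N}$, $n>1$, and $\eta\in(0,1)$, there exists a constant $C\ge1$ such that the following holds. Let $N\ge1$ be arbitrary and let $\phi=(\phi_2,\ldots,\phi_{2n+1}):\mathbb{V}\to\mathbb{W}$ be intrinsic $N$-Lipschitz. Then there exists a coronization $\mathcal{D}=\mathcal{G}\,\dot\cup\,\mathcal{B}$ with constant $C$, with associated forest $\mathcal{F}$, such that for every $\mathcal{T}\in\mathcal{F}$ there is an intrinsic Lipschitz map $$\phi_{\mathcal{T}}=(L_{\mathcal{T}}+\psi_{\mathcal{T}},\phi_{\mathcal{T},2n+1}):\mathbb{V}\to\mathbb{W},$$ where $L_{\mathcal{T}}:\mathbb{R}\to\mathbb{R}^{2n-1}$ is a linear $2N^2$-Lipschitz map and $\psi_{\mathcal{T}}:\mathbb{R}\to\mathbb{R}^{2n-1}$ is an $\eta N^2$-Lipschitz map, such that $$d(\phi(s),\phi_{\mathcal{T}}(s))\le(\eta N^2)|Q|\quad\text{for all }s\in2Q,\ Q\in\mathcal{T}.$$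
   Context: The $n$-th Heisenberg group $\mathbb{H}^n$ is $\mathbb{R}^{2n+1}$ with the group product $$(x_1,\ldots,x_{2n},t)\cdot(x_1',\ldots,x_{2n}',t')=\Big(x_1+x_1',\ldots,x_{2n}+x_{2n}',\,t+t'+\tfrac12\sum_{i=1}^n (x_ix_{n+i}'-x_i'x_{n+i})\Big),$$ with the metric $d(p,q):=\|q^{-1}\cdot p\|$, where $\|(x,t)\|:=\max\{|x|,\sqrt{|t|}\}$ for $(x,t)\in\mathbb{R}^{2n}\times\mathbb{R}$. Standing convention: $\mathbb{V}=\{(x_1,0,\ldots,0):x_1\in\mathbb{R}\}$ is a $1$-dimensional horizontal subgroup and $\mathbb{W}=\{(0,x_2,\ldots,x_{2n},t)\}$ its complementary vertical subgroup. Points of $\mathbb{V}$ are identified with $s\in\mathbb{R}$ and points of $\mathbb{W}$ with points of $\mathbb{R}^{2n}$, so $\phi=(\phi_2,\ldots,\phi_{2n+1}):\mathbb{R}\to\mathbb{R}^{2n}$, where $\phi_{2n+1}$ is the $t$-component. Every $p\in\mathbb{H}^n$ can be written uniquely as $p=\pi_{\mathbb{V}}(p)\cdot\pi_{\mathbb{W}}(p)$ with $\pi_{\mathbb{V}}(p)\in\mathbb{V}$, $\pi_{\mathbb{W}}(p)\in\mathbb{W}$. A map $\phi:\mathbb{V}\to\mathbb{W}$ is intrinsic $L$-Lipschitz if, with graph map $\Phi(v):=v\cdot\phi(v)$, $\|\pi_{\mathbb{W}}(\Phi(v')^{-1}\cdot\Phi(v))\|\le L\|\pi_{\mathbb{V}}(\Phi(v')^{-1}\cdot\Phi(v))\|$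 for all $v,v'\in\mathbb{V}$; it is intrinsic Lipschitz if this holds for some $L\ge0$. Lipschitz conditions on maps $\mathbb{R}\to\mathbb{R}^{2n-1}$ are Euclidean. In $d(\phi(s),\phi_{\mathcal{T}}(s))$ the values are regarded as points of $\mathbb{W}\subset\mathbb{H}^n$. $\mathcal{D}$ is the family of standard dyadic intervals of $\mathbb{R}$, $|Q|$ is the length of $Q$, and $2Q$ is the interval with the same midpoint as $Q$ and twice its length. A collection $\mathcal{T}\subset\mathcal{D}$ is a tree if: (T1) it contains a top interval $Q(\mathcal{T})$, i.e. a unique maximal element; (T2) if $Q\in\mathcal{T}$, then $Q'\in\mathcal{T}$ for all dyadic $Q'$ with $Q\subset Q'\subset Q(\mathcal{T})$; (T3) if $Q\in\mathcal{T}$, then either both or neither of the (dyadic) children of $Q$ lie in $\mathcal{T}$. A decomposition $\mathcal{D}=\mathcal{G}\,\dot\cup\,\mathcal{B}$ (disjoint) is a coronization with constant $C$ if (1) $\sum_{Q\in\mathcal{B},\,Q\subset Q_0}|Q|\le C|Q_0|$ for all $Q_0\in\mathcal{D}$; and (2) $\mathcal{G}$ is the disjoint union of a family (forest) $\mathcal{F}$ of trees with $\sum_{\mathcal{T}\in\mathcal{F},\,Q(\mathcal{T})\subset Q_0}|Q(\mathcal{T})|\le C|Q_0|$ for all $Q_0\in\mathcal{D}$. *)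

(* Defs.v *)
From mathcomp Require Import all_boot all_order all_algebra.
From mathcomp Require Import all_classical all_reals all_analysis.
From mathcomp Require Import ring lra zify.

Set Implicit Arguments.
Unset Strict Implicit.
Unset Printing Implicit Defensive.

Import Order.TTheory GRing.Theory Num.Theory.

Local Open Scope classical_set_scope.
Local Open Scope ring_scope.

(* The norm that the library puts on row vectors is the sup norm. *)
Definition enorm (R : realType) (m : nat) (x : 'rV[R]_m) : R :=
  Num.sqrt (\sum_(i < m) x 0 i ^+ 2).

Definition euclidean_lipschitz (R : realType) (m : nat) (K : R)
    (f : R -> 'rV[R]_m) : Prop :=
  forall s s', enorm (f s - f s') <= K * `|s - s'|.

(* The point (x_1, ..., x_2n, t) is the pair (x, t), where x_i is
   x 0 (lshift n (i - 1)) and x_(n+i) is x 0 (rshift n (i - 1)), 1 <= i <= n. *)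
Definition heis (R : realType) (n : nat) : Type := ('rV[R]_(n + n) * R)%type.

Definition hmul (R : realType) (n : nat) (p q : heis R n) : heis R n :=
  (p.1 + q.1,
   p.2 + q.2 + 2^-1 * \sum_(i < n) (p.1 0 (lshift n i) * q.1 0 (rshift n i)
                                  - q.1 0 (lshift n i) * p.1 0 (rshift n i))).

Definition hone (R : realType) (n : nat) : heis R n := (0, 0).

Definition hinv (R : realType) (n : nat) (p : heis R n) : heis R n :=
  (- p.1, - p.2).

Definition hnorm (R : realType) (n : nat) (p : heis R n) : R :=
  Num.max (enorm p.1) (Num.sqrt `|p.2|).

Definition hdist (R : realType) (n : nat) (p q : heis R n) : R :=
  hnorm (hmul (hinv q) p).

(* The subgroup V is R itself; the subgroup W is R^(2n-1) * R, the point
   (y, t) standing for (0, y_1, ..., y_(2n-1), t). *)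
Definition vert (R : realType) (n : nat) : Type :=
  ('rV[R]_(n + n).-1 * R)%type.

Definition of_V (R : realType) (n : nat) (s : R) : heis R n :=
  (\row_(i < n + n) (if i == 0%N :> nat then s else 0), 0).

(* The sum has at most one term: coordinate 0 is 0, coordinate j.+1 is y_j. *)
Definition of_W (R : realType) (n : nat) (w : vert R n) : heis R n :=
  (\row_(i < n + n) \sum_(j < (n + n).-1 | j.+1 == i :> nat) w.1 0 j, w.2).

Definition pi_V (R : realType) (n : nat) (p : heis R n) : heis R n :=
  (\row_(i < n + n) (if i == 0%N :> nat then p.1 0 i else 0), 0).

Definition pi_W (R : realType) (n : nat) (p : heis R n) : heis R n :=
  hmul (hinv (pi_V p)) p.

Definition graph_map (R : realType) (n : nat) (phi : R -> vert R n) (s : R) :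
  heis R n := hmul (of_V n s) (of_W (phi s)).

Definition intrinsic_lipschitz_with (R : realType) (n : nat) (L : R)
    (phi : R -> vert R n) : Prop :=
  forall v v' : R,
    let p := hmul (hinv (graph_map phi v')) (graph_map phi v) in
    hnorm (pi_W p) <= L * hnorm (pi_V p).

Definition intrinsic_lipschitz (R : realType) (n : nat)
    (phi : R -> vert R n) : Prop :=
  exists2 L : R, 0 <= L & intrinsic_lipschitz_with L phi.

(* (j, k) encodes the dyadic interval [k 2^j, (k + 1) 2^j), see dint_inj. *)
Definition dyadic : Type := (int * int)%type.

Definition dlen (R : realType) (Q : dyadic) : R := 2 ^ Q.1.

Definition dint (R : realType) (Q : dyadic) : set R :=
  `[Q.2%:~R * dlen R Q, (Q.2 + 1)%:~R * dlen R Q[.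
Arguments dint : clear implicits.

Definition dsub (R : realType) (Q Q' : dyadic) : Prop :=
  dint R Q `<=` dint R Q'.

Definition dmid (R : realType) (Q : dyadic) : R := (Q.2%:~R + 2^-1) * dlen R Q.

(* 2Q: its half-length is |Q|. *)
Definition ddouble (R : realType) (Q : dyadic) : set R :=
  `[dmid R Q - dlen R Q, dmid R Q + dlen R Q[.
Arguments ddouble : clear implicits.

Definition dchildl (Q : dyadic) : dyadic := (Q.1 - 1, 2 * Q.2).
Definition dchildr (Q : dyadic) : dyadic := (Q.1 - 1, 2 * Q.2 + 1).

Definition is_top (R : realType) (T : set dyadic) (Q : dyadic) : Prop :=
  T Q /\ forall Q', T Q' -> dsub R Q' Q.

Definition is_tree (R : realType) (T : set dyadic) : Prop :=
  exists top : dyadic,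
    [/\ is_top R T top,
        forall Q Q', T Q -> dsub R Q Q' -> dsub R Q' top -> T Q'
      & forall Q, T Q -> (T (dchildl Q) <-> T (dchildr Q))].

(* The default value (0, 0) is used only when T has no top interval; the top
   interval is unique, see is_top_uniq. *)
Definition tree_top (R : realType) (T : set dyadic) : dyadic :=
  xget ((0, 0) : dyadic) (is_top R T).

Definition coronization (R : realType) (C : R) (G B : set dyadic)
    (F : set (set dyadic)) : Prop :=
  [/\ G `|` B = setT,
      G `&` B = set0,
      forall Q0, (\esum_(Q in [set Q | B Q /\ dsub R Q Q0]) (dlen R Q)%:E
                  <= (C * dlen R Q0)%:E)%E
    & [/\ forall T, F T -> is_tree R T,
          trivIset F id,
          G = \bigcup_(T in F) T
        & forall Q0,
            (\esum_(T in [set T | F T /\ dsub R (tree_top R T) Q0])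
                (dlen R (tree_top R T))%:E <= (C * dlen R Q0)%:E)%E]].

Section HeisenbergFacts.
Variables (R : realType) (n : nat).
Implicit Types p q : heis R n.

Lemma heis_eq p q : p.1 = q.1 -> p.2 = q.2 -> p = q.
Proof. by case: p q => [x t] [y u] /= -> ->. Qed.

Lemma hmulA p q r : hmul p (hmul q r) = hmul (hmul p q) r.
Proof.
apply: heis_eq; rewrite /= ?addrA// -!addrA; do 2 congr (_ + _).
rewrite [RHS]addrCA; congr (_ + _).
rewrite -!mulrDr -!big_split /=; congr (_ * _).
by apply: eq_bigr => i _; rewrite !mxE; ring.
Qed.

Lemma hmul1p p : hmul (hone R n) p = p.
Proof.
apply: heis_eq; rewrite /= ?add0r// big1 ?mulr0 ?addr0// => i _.
by rewrite !mxE mul0r mulr0 subrr.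
Qed.

Lemma hmulVp p : hmul (hinv p) p = hone R n.
Proof.
apply: heis_eq; rewrite /= ?addNr// add0r big1 ?mulr0// => i _.
by rewrite !mxE; ring.
Qed.

Lemma hmulpV p : hmul p (hinv p) = hone R n.
Proof.
apply: heis_eq; rewrite /= ?subrr// add0r big1 ?mulr0// => i _.
by rewrite !mxE; ring.
Qed.

Lemma of_W0 (w : vert R n) (i : 'I_(n + n)) : i = 0%N :> nat ->
  (of_W w).1 0 i = 0.
Proof. by move=> i0; rewrite mxE big1// => j; rewrite i0. Qed.

Lemma of_WS (w : vert R n) (i : 'I_(n + n)) (j : 'I_(n + n).-1) :
  i = j.+1 :> nat -> (of_W w).1 0 i = w.1 0 j.
Proof.
move=> ij; rewrite mxE (bigD1 j) ?ij//= big1 ?addr0// => k.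
by rewrite eqSS => /andP[/eqP/val_inj ->]; rewrite eqxx.
Qed.

Lemma pi_decomp p : p = hmul (pi_V p) (pi_W p).
Proof. by rewrite /pi_W hmulA hmulpV hmul1p. Qed.

Lemma pi_V_of p : (0 < n)%N -> exists s, pi_V p = of_V n s.
Proof.
move=> n0; have nn0 : (0 < n + n)%N by rewrite addn_gt0 n0.
exists (p.1 0 (Ordinal nn0)); apply: heis_eq => //=.
apply/rowP => i; rewrite !mxE; case: eqP => // i0.
by congr (p.1 _ _); apply: val_inj.
Qed.

Lemma pi_W_of p : exists w, pi_W p = of_W w.
Proof.
have jP (j : 'I_(n + n).-1) : (j.+1 < n + n)%N by case: j => j /=; lia.
exists (\row_j p.1 0 (Ordinal (jP j)), (pi_W p).2); apply: heis_eq => //=.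
apply/rowP => i; rewrite !mxE; case: eqP => [i0|i0].
  by rewrite addNr big1// => j; rewrite i0.
have iP : (i.-1 < (n + n).-1)%N by case: i i0 => i /=; lia.
rewrite oppr0 add0r (bigD1 (Ordinal iP)) /=; last by rewrite prednK; lia.
rewrite mxE big1 ?addr0; last first.
  by move=> j /andP[/eqP ji /eqP]; case; apply: val_inj; rewrite /= -ji.
by congr (p.1 _ _); apply: val_inj => /=; lia.
Qed.

Lemma pi_uniq (s : R) (w : vert R n) :
  pi_V (hmul (of_V n s) (of_W w)) = of_V n s
  /\ pi_W (hmul (of_V n s) (of_W w)) = of_W w.
Proof.
have eV : pi_V (hmul (of_V n s) (of_W w)) = of_V n s.
  apply: heis_eq => //=; apply/rowP => i; rewrite !mxE; case: eqP => // i0.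
  by rewrite big1 ?addr0// => j; rewrite i0.
by split=> //; rewrite /pi_W eV hmulA hmulVp hmul1p.
Qed.

End HeisenbergFacts.

Section DyadicFacts.
Variable R : realType.

Lemma dlen_gt0 Q : 0 < dlen R Q.
Proof. by rewrite exprz_gt0// ltr0n. Qed.

Lemma dsub_ends Q Q' : dsub R Q Q' ->
  Q'.2%:~R * dlen R Q' <= Q.2%:~R * dlen R Q
  /\ (Q.2 + 1)%:~R * dlen R Q <= (Q'.2 + 1)%:~R * dlen R Q'.
Proof.
have Q0 := dlen_gt0 Q.
rewrite /dsub /dint; set a := _ * dlen R Q; set b := _ * dlen R Q.
set a' := _ * dlen R Q'; set b' := _ * dlen R Q' => sub.
have ab : a < b by rewrite /a /b ltr_pM2r// ltr_int ltrDl.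
have /= := sub a; rewrite !in_itv/= lexx ab => /(_ isT)/andP[a'a ab'].
split=> //; rewrite leNgt; apply/negP => b'b.
by have /= := sub b'; rewrite !in_itv/= ltxx andbF (ltW ab') b'b => /(_ isT).
Qed.

Lemma dint_inj : injective (dint R).
Proof.
move=> [j k] [j' k'] e.
have [/= l1 r1] : _ /\ _ := @dsub_ends (j, k) (j', k') ltac:(by rewrite /dsub e).
have [/= l2 r2] : _ /\ _ := @dsub_ends (j', k') (j, k) ltac:(by rewrite /dsub e).
have lE : k%:~R * dlen R (j, k) = k'%:~R * dlen R (j', k').
  by apply/eqP; rewrite eq_le l1 l2.
have dE : dlen R (j, k) = dlen R (j', k').
  have : (k + 1)%:~R * dlen R (j, k) = (k' + 1)%:~R * dlen R (j', k').
    by apply/eqP; rewrite eq_le r1 r2.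
  by rewrite !intrD !mulrDl lE !mul1r => /addrI.
have jj : j = j'.
  by move: dE; rewrite /dlen /=; apply: ieexprIz; rewrite ?ltr0n ?pnatr_eq1.
move: lE; rewrite dE => /(mulIf (lt0r_neq0 (dlen_gt0 _)))/intr_inj ->.
by rewrite jj.
Qed.

Lemma dchild_partition Q :
  dint R Q = dint R (dchildl Q) `|` dint R (dchildr Q).
Proof.
have e : dlen R Q = 2 * dlen R (dchildl Q).
  by rewrite /dlen /= expfzDr ?pnatr_eq0// mulrC exprN1 mulfVK ?pnatr_eq0.
have l0 := dlen_gt0 (dchildl Q).
have -> : dint R Q = `[(2 * Q.2)%:~R * dlen R (dchildl Q),
                       (2 * Q.2 + 1 + 1)%:~R * dlen R (dchildl Q)[%classic.
  rewrite /dint e; apply/seteqP; split => x /=; rewrite !in_itv /=;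
    rewrite !intrD !intrM; lra.
rewrite /dint /dchildr /dchildl /dlen /= in l0 *.
set l := 2 ^ _ in l0 *; set k := 2 * Q.2.
have h1 : k%:~R * l < (k + 1)%:~R * l by rewrite ltr_pM2r// ltr_int ltrDl.
have h2 : (k + 1)%:~R * l < (k + 1 + 1)%:~R * l.
  by rewrite ltr_pM2r// ltr_int ltrDl.
apply/seteqP; split => x /=; rewrite !in_itv /=.
  by move=> /andP[ax xb]; case: (ltP x ((k + 1)%:~R * l)) => h;
    [left; rewrite ax | right; rewrite xb].
move=> [] /andP[u v]; apply/andP; split=> //.
- exact: lt_trans v h2.
- exact: le_trans (ltW h1) u.
Qed.

Lemma is_top_uniq T Q Q' : is_top R T Q -> is_top R T Q' -> Q = Q'.
Proof.
move=> [TQ h] [TQ' h']; apply: dint_inj; apply/seteqP.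
by split; [exact: h' | exact: h].
Qed.

Lemma tree_topP T : is_tree R T -> is_top R T (tree_top R T).
Proof. by move=> [Q [hQ _ _]]; rewrite /tree_top; case: xgetP => // /(_ Q). Qed.

End DyadicFacts.

(* Main.v *)
From HB Require Import structures.
Require Import Defs.
From mathcomp Require Import all_boot all_order all_algebra.
From mathcomp Require Import all_classical all_reals all_analysis.
From mathcomp Require Import ring lra zify.
From mathcomp Require finmap.

Set Implicit Arguments.
Unset Strict Implicit.
Unset Printing Implicit Defensive.

Import Order.TTheory GRing.Theory Num.Theory.
Local Open Scope classical_set_scope.
Local Open Scope ring_scope.

(** Write phi = (y, t) with y valued in R^(2n-1). Unwinding the group law, phi is
    intrinsic Lipschitz exactly when y is Lipschitz and the horizontal defect
      t(s') - t(s) + (s' - s) y_(n+1)(s) - omega(y(s), y(s')) / 2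
    is O((s' - s)^2) (intrinsic_lipschitz_withE): the graph is a horizontal curve,
    and t is determined by y up to an additive constant. The theorem follows by
    combining a corona decomposition of y with a construction of horizontal curves.

    The Euclidean part is lipschitz_corona: off a packed family of bad intervals the
    dyadic intervals split into trees such that, for every Q in a tree, y is
    eps N |Q|-close on the triple of Q to a line whose slope is that of the tree.
    Everything is read off slopes over intervals. The quantity
    |I| (N^2 - slope(I)^2) is nonnegative, at most N^2 |I|, and loses at each
    bisection an amount that measures the change of slope; so y can fail to be flat
    only on a packed family of intervals (packing_not_flat). Triples of dyadic
    intervals are bisected into triples, which brings the neighbours of Q under the
    same argument. A tree is stopped when the slope of a child leaves the slope of
    the top; stops are paid for by the same quantity increased by the squared
    distance to the slope of the top (packing_turning).

    The horizontal part produces, for one tree, a horizontal curve that returns to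
    the given one at all the scales of the tree. Replacing y by its chords on the
    minimal intervals of the tree is not enough, since the last coordinate of the
    horizontal lift would drift away from t. But the coordinate y_(n+1) is not seen
    by omega, so adding to each chord a parabolic bump in that coordinate shifts the
    end of the lift by the integral of the bump, and the height can be chosen so that
    the lift ends on the given curve (fill_right). Two N-Lipschitz horizontal curves
    that are E-close in the W-coordinates separate at speed O(E N) (vdiff_drift), so
    the bump has slope O(eps N^2): this is where N^2 comes from. The resulting map
    tree_map agrees with phi on the skeleton of the tree, which contains the
    endpoints of all tree intervals; second order horizontality passes from the
    pieces to the whole (tame_trans), and comparing from the left end of Q gives the
    distance estimate on 2Q (tree_map_near, tree_map_vdiff). *)

(** * Dyadic intervals and packing sums *)

Definition dpar (Q : dyadic) : dyadic := (Q.1 + 1, (Q.2 %/ 2)%Z).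

Definition ancestor (Q Q' : dyadic) : Prop := exists i, iter i dpar Q = Q'.

Lemma dpar_childl Q : dpar (dchildl Q) = Q.
Proof. by case: Q => j k; rewrite /dpar /dchildl /=; congr pair; lia. Qed.

Lemma dpar_childr Q : dpar (dchildr Q) = Q.
Proof. by case: Q => j k; rewrite /dpar /dchildr /=; congr pair; lia. Qed.

Lemma dpar_cases Q : Q = dchildl (dpar Q) \/ Q = dchildr (dpar Q).
Proof.
case: Q => j k; rewrite /dpar /dchildl /dchildr /=.
have [e|e] : k = 2 * (k %/ 2)%Z \/ k = 2 * (k %/ 2)%Z + 1 by lia.
- by left; congr pair; lia.
- by right; congr pair; lia.
Qed.

Lemma iter_dparE n (j k k' : int) :
  k' * 2 ^+ n <= k -> k + 1 <= (k' + 1) * 2 ^+ n ->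
  iter n dpar (j, k) = (j + n%:Z, k').
Proof.
elim: n j k => [|n IH] j k.
  by rewrite expr0 !mulr1 => h1 h2; rewrite /= addr0; congr pair; lia.
rewrite exprS => h1 h2; rewrite iterSr /dpar /= IH; first by congr pair; lia.
- by move: h1; set z := 2 ^+ n; rewrite mulrCA; lia.
- by move: h2; set z := 2 ^+ n; rewrite mulrCA; lia.
Qed.

Section Packing.
Variable R : realType.

Lemma dlen_par Q : dlen R (dpar Q) = 2 * dlen R Q.
Proof. by rewrite /dlen /= expfzDr ?pnatr_eq0// mulrC expr1z. Qed.

Lemma dlen_childl Q : dlen R (dchildl Q) = dlen R Q / 2.
Proof. by rewrite -{2}(dpar_childl Q) dlen_par; field. Qed.

Lemma dlen_childr Q : dlen R (dchildr Q) = dlen R Q / 2.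
Proof. by rewrite -{2}(dpar_childr Q) dlen_par; field. Qed.

Lemma dsub_refl Q : dsub R Q Q. Proof. by []. Qed.

Lemma dsub_trans Q2 Q1 Q3 : dsub R Q1 Q2 -> dsub R Q2 Q3 -> dsub R Q1 Q3.
Proof. exact: subset_trans. Qed.

Lemma dsub_par Q : dsub R Q (dpar Q).
Proof.
rewrite /dsub [X in _ `<=` X]dchild_partition.
by case: (dpar_cases Q) => {1}-> x; [left|right].
Qed.

Lemma dsubP Q Q' : dsub R Q Q' <-> ancestor Q Q'.
Proof.
split=> [QQ'|[i <-]]; last first.
  elim: i => [|i IH]; first exact: dsub_refl.
  by rewrite iterS; apply: (@dsub_trans (iter i dpar Q)) => //; apply: dsub_par.
case: Q Q' QQ' => j k [j' k'] /dsub_ends /= [h1 h2].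
have jj' : j <= j'.
  have : dlen R (j, k) <= dlen R (j', k').
    by move: h1 h2; rewrite !intrD !mulrDl !mul1r; lra.
  by rewrite /dlen /= ler_eXz2l ?ltr1n.
have [m em] : exists m : nat, j' = j + m%:Z by exists `|j' - j|%N; lia.
have eD : dlen R (j', k') = 2 ^+ m * dlen R (j, k).
  by rewrite /dlen /= em expfzDr ?pnatr_eq0// mulrC.
have l0 := dlen_gt0 R (j, k).
exists m; rewrite (@iter_dparE _ _ _ k') ?em//.
- by move: h1; rewrite eD mulrA ler_pM2r// -(ler_int R) intrM rmorphXn.
- by move: h2; rewrite eD mulrA ler_pM2r// -(ler_int R) intrM rmorphXn.
Qed.

Lemma ancestor_cases Q Q' : ancestor Q Q' -> Q = Q' \/ ancestor (dpar Q) Q'.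
Proof. by case=> -[|i] <-; [left|right; exists i; rewrite iterSr]. Qed.

Section Potential.
Variables (T : eqType) (par l r : T -> T).
Hypothesis par_cases : forall x, x = l (par x) \/ x = r (par x).
Variables (A : T -> Prop) (w P : T -> R).
Hypothesis P_ge0 : forall x, 0 <= P x.
Hypothesis P_drop : forall x, P (l x) + P (r x) <= P x.
Hypothesis P_charge : forall x, A x -> P (l x) + P (r x) + w x <= P x.

(** By induction on the depth m: the members of X below q split into q itself and
    those below each child, and the drop of P from q to its children pays for q. *)
Lemma potential_bound_depth m q (X : seq T) : uniq X ->
  (forall x, x \in X -> A x /\ exists2 i, (i <= m)%N & iter i par x = q) ->
  \sum_(x <- X) w x <= P q.
Proof.
elim: m q X => [|m IH] q X uX XA.
  case: X uX XA => [|x X] uX XA; first by rewrite big_nil.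
  have Xq z : z \in x :: X -> z = q by move=> /XA[_ [[|i]]].
  have e : X = [::].
    case: X uX Xq {XA} => // z X; rewrite /= inE negb_or => /andP[/andP[/eqP xz _] _] Xq.
    by case: xz; rewrite (Xq x) ?inE ?eqxx// (Xq z) ?inE ?eqxx ?orbT.
  rewrite e big_seq1; have [Ax [[|i]//= _ xq]] := XA x (mem_head _ _).
  have := P_charge Ax; have := P_ge0 (l x); have := P_ge0 (r x).
  rewrite -xq; lra.
pose B x := (x != q) && `[< exists2 i, (i <= m)%N & iter i par x = l q >].
rewrite (bigID (fun x => x == q))/= [X in _ + X](bigID B)/=.
have b1 : \sum_(x <- X | (x != q) && B x) w x <= P (l q).
  rewrite -big_filter; apply: IH; first exact: filter_uniq.
  move=> x; rewrite mem_filter => /andP[/andP[_ /andP[_ /asboolP Bx]] /XA[Ax _]].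
  by split.
have b2 : \sum_(x <- X | (x != q) && ~~ B x) w x <= P (r q).
  rewrite -big_filter; apply: IH; first exact: filter_uniq.
  move=> x; rewrite mem_filter => /andP[/andP[xq]].
  rewrite /B xq/= => /asboolP Bx /XA[Ax [[|i] im xi]]; first by rewrite -xi eqxx in xq.
  split=> //; exists i => //; case: (par_cases (iter i par x)); rewrite -iterS xi => // e.
  by case: Bx; exists i.
have [qX|qX] := boolP (q \in X).
  have [Aq _] := XA q qX.
  have -> : \sum_(x <- X | x == q) w x = w q.
    by rewrite (big_rem q)//= eqxx big1_seq ?addr0// => x /andP[/eqP ->]; rewrite mem_rem_uniqF.
  have := P_charge Aq; lra.
rewrite big1_seq; first by have := P_drop q; lra.
by move=> x /andP[/eqP ->]; rewrite (negbTE qX).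
Qed.

Lemma potential_bound q (X : seq T) : uniq X ->
  (forall x, x \in X -> A x /\ exists i, iter i par x = q) ->
  \sum_(x <- X) w x <= P q.
Proof.
move=> uX XA.
have [m hm] : exists m, forall x, x \in X -> exists2 i, (i <= m)%N & iter i par x = q.
  elim: X {uX} XA => [|x X IH] XA; first by exists 0%N.
  have [|m hm] := IH; first by move=> z zX; apply: XA; rewrite inE zX orbT.
  have [_ [i xi]] := XA x (mem_head _ _).
  exists (maxn i m) => z; rewrite inE => /orP[/eqP ->|/hm[k km zk]].
    by exists i => //; rewrite leq_maxl.
  by exists k => //; rewrite leq_max km orbT.
by apply: (@potential_bound_depth m) => // x xX; split; [have [] := XA x xX|exact: hm].
Qed.

End Potential.

(** The Carleson packing condition, tested on finite subfamilies; see esum_le_seq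
    for the passage to infinite sums. *)
Definition packing (A : set dyadic) (C : R) : Prop :=
  forall Q0 (X : seq dyadic), uniq X ->
    (forall Q, Q \in X -> A Q /\ ancestor Q Q0) ->
    \sum_(Q <- X) dlen R Q <= C * dlen R Q0.

Lemma packing_potential (A : set dyadic) (C : R) (P : dyadic -> R) :
  (forall Q, 0 <= P Q <= C * dlen R Q) ->
  (forall Q, P (dchildl Q) + P (dchildr Q) <= P Q) ->
  (forall Q, A Q -> P (dchildl Q) + P (dchildr Q) + dlen R Q <= P Q) ->
  packing A C.
Proof.
move=> P0 Pd Pc Q0 X uX XA; have /andP[_] := P0 Q0; apply: le_trans.
apply: (potential_bound dpar_cases _ Pd Pc) => // Q.
by case/andP: (P0 Q).
Qed.

Lemma packing_sub (A B : set dyadic) C :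
  A `<=` B -> packing B C -> packing A C.
Proof. by move=> AB pB Q0 X uX XA; apply: pB => // Q /XA[/AB]. Qed.

Lemma packingU (A B : set dyadic) C D :
  packing A C -> packing B D -> packing (A `|` B) (C + D).
Proof.
move=> pA pB Q0 X uX XA; rewrite (bigID (fun Q => `[< A Q >]))/= mulrDl lerD//.
  rewrite -big_filter; apply: pA; first exact: filter_uniq.
  by move=> Q; rewrite mem_filter => /andP[/asboolP AQ /XA[]].
rewrite -big_filter; apply: pB; first exact: filter_uniq.
by move=> Q; rewrite mem_filter => /andP[/asboolP AQ /XA[[]]].
Qed.

Lemma packing_map (A B : set dyadic) (f : dyadic -> dyadic) c C :
  0 <= c -> injective f -> (forall Q, B Q -> A (f Q)) ->
  (forall Q, dlen R Q = c * dlen R (f Q)) ->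
  (forall Q Q0, ancestor Q Q0 -> ancestor (f Q) Q0) ->
  packing A C -> packing B (c * C).
Proof.
move=> c0 fI BA lf fa pA Q0 X uX XB.
rewrite (eq_bigr (fun Q => c * dlen R (f Q))); last by move=> Q _.
rewrite -mulr_sumr -mulrA ler_wpM2l// -(big_map f xpredT).
apply: pA => [|_ /mapP[Q /XB[BQ QQ0] ->]]; first by rewrite map_inj_uniq.
by split; [exact: BA|exact: fa].
Qed.

Lemma packing_childl (A : set dyadic) C :
  packing A C -> packing [set Q | A (dchildl Q)] (2 * C).
Proof.
apply: (@packing_map _ _ dchildl) => // [Q Q' e|Q|Q Q0 [i <-]].
- by rewrite -(dpar_childl Q) e dpar_childl.
- by rewrite dlen_childl; field.
- by exists i.+1; rewrite iterSr dpar_childl.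
Qed.

Lemma packing_childr (A : set dyadic) C :
  packing A C -> packing [set Q | A (dchildr Q)] (2 * C).
Proof.
apply: (@packing_map _ _ dchildr) => // [Q Q' e|Q|Q Q0 [i <-]].
- by rewrite -(dpar_childr Q) e dpar_childr.
- by rewrite dlen_childr; field.
- by exists i.+1; rewrite iterSr dpar_childr.
Qed.

(** Each interval is half of its parent, and a parent is hit by at most one left and
    one right child. The extra 1 accounts for Q0, the only interval below Q0 whose
    parent is not. *)
Lemma packing_par (A : set dyadic) C :
  packing A C -> packing [set Q | A (dpar Q)] (C + 1).
Proof.
move=> pA Q0 X uX XA.
rewrite (bigID (fun Q => Q == Q0))/= addrC mulrDl mul1r lerD//; last first.
  have [Q0X|Q0X] := boolP (Q0 \in X).
    rewrite (big_rem Q0)//= eqxx big1_seq ?addr0// => x /andP[/eqP ->].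
    by rewrite mem_rem_uniqF.
  by rewrite big1_seq ?ltW ?dlen_gt0// => x /andP[/eqP ->]; rewrite (negbTE Q0X).
rewrite (bigID (fun Q => Q == dchildl (dpar Q)))/=.
have half (c : dyadic -> dyadic) (B : pred dyadic) :
    (forall Q, B Q -> Q = c (dpar Q)) ->
    \sum_(Q <- X | (Q != Q0) && B Q) dlen R Q <= C / 2 * dlen R Q0.
  move=> Bc; rewrite -big_filter.
  rewrite (eq_bigr (fun Q => 2^-1 * dlen R (dpar Q))); last first.
    by move=> Q _; rewrite dlen_par; field.
  rewrite -mulr_sumr [C / 2]mulrC -mulrA ler_wpM2l ?invr_ge0//.
  rewrite -(big_map dpar xpredT (dlen R)); apply: pA.
    rewrite map_inj_in_uniq ?filter_uniq// => Q Q'.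
    rewrite !mem_filter => /andP[/andP[_ /Bc eQ] _] /andP[/andP[_ /Bc eQ'] _] e.
    by rewrite eQ eQ' e.
  move=> _ /mapP[Q + ->]; rewrite mem_filter => /andP[/andP[QQ0 _]].
  by move=> /XA[AQ /ancestor_cases[e|//]]; rewrite e eqxx in QQ0.
have h1 := half dchildl _ (fun Q => elimT eqP).
have h2 : \sum_(Q <- X | (Q != Q0) && (Q != dchildl (dpar Q))) dlen R Q
    <= C / 2 * dlen R Q0.
  by apply: (half dchildr) => Q /eqP; case: (dpar_cases Q).
by lra.
Qed.

Lemma esum_le_seq (T : choiceType) (A : set T) (f : T -> R) (M : R) :
  (forall X : seq T, uniq X -> (forall x, x \in X -> A x) -> \sum_(x <- X) f x <= M) ->
  (\esum_(x in A) (f x)%:E <= M%:E)%E.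
Proof.
move=> h; apply: ge_ereal_sup => _ [X [finX XA] <-].
rewrite fsbig_finite//= sumEFin lee_fin; apply: h; first exact: finmap.fset_uniq.
by move=> x; rewrite in_fset_set// inE => /XA.
Qed.

End Packing.

(** * The slope defect of a Lipschitz function *)

Section Defect.
Variables (R : realType) (I : finType) (N : R) (y : I -> R -> R).
Hypothesis N_gt0 : 0 < N.
Hypothesis y_lip : forall i s s', `|y i s - y i s'| <= N * `|s - s'|.

Definition slope (i : I) (p h : R) : R := (y i (p + h) - y i p) / h.

(** Squares being convex, bisecting an interval decreases its defect, and the loss is
    a sum of squares of slope jumps (defect_split): it measures how much y bends. *)
Definition defect (p h : R) : R := \sum_i h * (N ^+ 2 - slope i p h ^+ 2).

Fixpoint defect_at (l : nat) (p h : R) : R :=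
  if l is l'.+1 then defect_at l' p (h / 2) + defect_at l' (p + h / 2) (h / 2)
  else defect p h.

Lemma slope_bound i p h : 0 < h -> `|slope i p h| <= N.
Proof.
move=> h0; rewrite /slope normrM normfV (gtr0_norm h0) ler_pdivrMr//.
by apply: le_trans (y_lip _ _ _) _; rewrite addrAC subrr add0r gtr0_norm.
Qed.

Lemma slope_sqr_bound i p h : 0 < h -> slope i p h ^+ 2 <= N ^+ 2.
Proof.
move=> h0; rewrite -(real_normK (num_real (slope i p h))) ler_sqr ?nnegrE ?(ltW N_gt0)//.
exact: slope_bound.
Qed.

Lemma slope_double i p h : h != 0 ->
  slope i p h = (slope i p (h / 2) + slope i (p + h / 2) (h / 2)) / 2.
Proof.
move=> h0; rewrite /slope -addrA -splitr.
by field.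
Qed.

Lemma defect_ge0 p h : 0 < h -> 0 <= defect p h.
Proof.
move=> h0; apply: sumr_ge0 => i _.
by rewrite mulr_ge0 ?(ltW h0)// subr_ge0 slope_sqr_bound.
Qed.

Lemma defect_le p h : 0 < h -> defect p h <= #|I|%:R * N ^+ 2 * h.
Proof.
move=> h0; rewrite -mulrA mulr_natl -sumr_const; apply: ler_sum => i _.
by rewrite mulrC ler_wpM2r ?(ltW h0)// gerBl sqr_ge0.
Qed.

Lemma defect_split p h : h != 0 ->
  defect p h = defect p (h / 2) + defect (p + h / 2) (h / 2)
    + \sum_i h / 4 * (slope i p (h / 2) - slope i (p + h / 2) (h / 2)) ^+ 2.
Proof.
move=> h0; rewrite /defect -!big_split; apply: eq_bigr => i _ /=.
by rewrite (@slope_double i p h)//; field.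
Qed.

Lemma defect_at_ge0 l p h : 0 < h -> 0 <= defect_at l p h.
Proof.
elim: l p h => [|l IH] p h h0 /=; first exact: defect_ge0.
by rewrite addr_ge0// IH// divr_gt0.
Qed.

Lemma defect_at_le l p h : 0 < h -> defect_at l p h <= defect p h.
Proof.
elim: l p h => [|l IH] p h h0 //=.
have h2 : 0 < h / 2 by rewrite divr_gt0.
rewrite (defect_split _ (lt0r_neq0 h0)).
have : 0 <= \sum_i h / 4 * (slope i p (h / 2) - slope i (p + h / 2) (h / 2)) ^+ 2.
  by apply: sumr_ge0 => i _; rewrite mulr_ge0 ?sqr_ge0 ?divr_ge0 ?ltW.
have := IH p _ h2; have := IH (p + h / 2) _ h2; lra.
Qed.

(** Linearising the bend z = a - b of a bisection: the deviation it causes is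
    estimated by the defect it costs, without square roots, so that the estimates add
    up along generations. *)
Lemma young_quarter (z t h : R) : 0 < t -> 0 <= h ->
  `|z| * h / 4 <= h / 4 * z ^+ 2 / t + t * h / 16.
Proof.
move=> t0 h0; rewrite -(real_normK (num_real z)); set u := `|z|.
rewrite -subr_ge0; have -> : h / 4 * u ^+ 2 / t + t * h / 16 - u * h / 4
  = h / t * (u / 2 - t / 4) ^+ 2 by field; rewrite lt0r_neq0.
by rewrite mulr_ge0 ?sqr_ge0 ?divr_ge0 ?(ltW t0).
Qed.

(** If y loses little defect in l bisections then it stays near its chord. At each
    bisection the chord moves by at most h |a - b| / 4 while the defect drops by
    h (a - b) ^ 2 / 4; by young_quarter these moves sum to the defect drop over t plus a
    geometric series in t h. After l bisections the Lipschitz bound finishes. *)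
Lemma deviation_le i l (p h t s : R) : 0 < h -> 0 < t -> p <= s <= p + h ->
  `|y i s - y i p - slope i p h * (s - p)|
    <= (defect p h - defect_at l p h) / t + t * h / 8 + 2 * N * h / 2 ^+ l.
Proof.
elim: l p h => [|l IH] p h h0 t0 /andP[ps sh].
  rewrite /= subrr mul0r add0r expr0 divr1.
  apply: (@le_trans _ _ (2 * N * h)); last by rewrite lerDr divr_ge0 ?mulr_ge0 ?ltW.
  apply: le_trans (ler_normB _ _) _; rewrite normrM.
  have sp0 : 0 <= s - p by rewrite subr_ge0.
  have : `|y i s - y i p| <= N * h.
    by apply: le_trans (y_lip _ _ _) _; rewrite ler_pM2l// ger0_norm//; lra.
  have : `|slope i p h| * `|s - p| <= N * h.
    by apply: ler_pM => //; [exact: slope_bound|rewrite ger0_norm//; lra].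
  lra.
have h2 : 0 < h / 2 by rewrite divr_gt0.
set a := slope i p (h / 2); set b := slope i (p + h / 2) (h / 2).
have tV : 0 <= t^-1 by rewrite invr_ge0 ltW.
have gain : h / 4 * (a - b) ^+ 2 / t
    <= (defect p h - defect p (h / 2) - defect (p + h / 2) (h / 2)) / t.
  rewrite ler_wpM2r// (defect_split _ (lt0r_neq0 h0)).
  rewrite (bigD1 i)//= -/a -/b -!addrA [X in _ <= X]addrC !addrA.
  rewrite -subr_ge0; set S := \sum_(_ | _) _.
  have : 0 <= S by apply: sumr_ge0 => j _; rewrite mulr_ge0 ?sqr_ge0 ?divr_ge0 ?ltW.
  lra.
have am := young_quarter (a - b) t0 (ltW h0).
rewrite (@slope_double i p h (lt0r_neq0 h0)) -/a -/b /= exprS.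
have e2 : 2 * N * h / (2 * 2 ^+ l) = 2 * N * (h / 2) / 2 ^+ l.
  by field; rewrite expf_neq0// pnatr_eq0.
rewrite e2.
have [sm|ms] := leP s (p + h / 2).
  have := IH p (h / 2) h2 t0; rewrite ps sm => /(_ isT); rewrite -/a => IHs.
  have pos : 0 <= (defect (p + h / 2) (h / 2) - defect_at l (p + h / 2) (h / 2)) / t.
    by rewrite mulr_ge0// subr_ge0 defect_at_le.
  have -> : y i s - y i p - (a + b) / 2 * (s - p)
    = (y i s - y i p - a * (s - p)) + (a - b) * (s - p) / 2 by field.
  apply: le_trans (ler_normD _ _) _.
  have : `|(a - b) * (s - p) / 2| <= `|a - b| * h / 4.
    rewrite !normrM (@ger0_norm _ (s - p)) ?subr_ge0// (@ger0_norm _ 2^-1) ?invr_ge0//.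
    by rewrite -!mulrA ler_wpM2l//; lra.
  lra.
have := IH (p + h / 2) (h / 2) h2 t0; rewrite (ltW ms) -addrA -splitr sh => /(_ isT).
rewrite -/b => IHs.
have pos : 0 <= (defect p (h / 2) - defect_at l p (h / 2)) / t.
  by rewrite mulr_ge0// subr_ge0 defect_at_le.
have ea : y i (p + h / 2) - y i p = a * (h / 2).
  by rewrite /a /slope mulfVK// lt0r_neq0.
have -> : y i s - y i p - (a + b) / 2 * (s - p)
  = (y i s - y i (p + h / 2) - b * (s - (p + h / 2))) + (a - b) * (p + h - s) / 2.
  have -> : y i (p + h / 2) = y i p + a * (h / 2) by lra.
  by field.
apply: le_trans (ler_normD _ _) _.
have : `|(a - b) * (p + h - s) / 2| <= `|a - b| * h / 4.
  rewrite !normrM (@ger0_norm _ (p + h - s)) ?subr_ge0// (@ger0_norm _ 2^-1) ?invr_ge0//.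
  by rewrite -!mulrA ler_wpM2l//; lra.
lra.
Qed.

End Defect.

(** * Flatness on tripled intervals *)

(** The node (j, k) also stands for the triple [(k - 1) 2 ^ j, (k + 2) 2 ^ j) of the
    dyadic interval (j, k). The two halves of a triple are again triples of dyadic
    intervals, so triples form binary trees of their own and neighbours of Q can be
    handled by the same telescoping as Q itself. *)
Definition tchildl (Q : dyadic) : dyadic := (Q.1 - 1, 2 * Q.2 - 1).
Definition tchildr (Q : dyadic) : dyadic := (Q.1 - 1, 2 * Q.2 + 2).
Definition tpar (Q : dyadic) : dyadic :=
  (Q.1 + 1, ((Q.2 + 1)%R %/ 2)%Z - ((Q.2 + 1)%R %% 2)%Z).

Lemma tpar_cases Q : Q = tchildl (tpar Q) \/ Q = tchildr (tpar Q).
Proof.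
case: Q => j k; rewrite /tpar /tchildl /tchildr /=.
have [e|e] : ((k + 1)%R %% 2)%Z = 0 \/ ((k + 1)%R %% 2)%Z = 1 by lia.
- by left; congr pair; lia.
- by right; congr pair; lia.
Qed.

(** The triple tree follows the dyadic tree up to one step sideways. *)
Lemma tpar_near (j k k' : int) : `|k' - k|%N <= 1 :> int ->
  exists2 k1, tpar (j, k') = ((dpar (j, k)).1, k1) & `|k1 - (dpar (j, k)).2|%N <= 1 :> int.
Proof. by move=> h; exists (tpar (j, k')).2; rewrite /tpar /dpar//=; lia. Qed.

Lemma iter_tpar_near i (j k : int) :
  exists2 k1, iter i tpar (j, k) = ((iter i dpar (j, k)).1, k1)
   & `|k1 - (iter i dpar (j, k)).2|%N <= 1 :> int.
Proof.
elim: i => [|i [k1 e h]]; first by exists k => //=; lia.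
rewrite !iterS e; case: (iter i dpar (j, k)) h => j' k' /= h.
by have [k2 -> h2] := tpar_near j' h; exists k2.
Qed.

Section Flat.
Variables (R : realType).

Definition dleft (Q : dyadic) : R := Q.2%:~R * dlen R Q.

Lemma dlen_tchildl Q : dlen R (tchildl Q) = dlen R Q / 2.
Proof. by rewrite -(dlen_childl R Q). Qed.

Lemma dlen_tchildr Q : dlen R (tchildr Q) = dlen R Q / 2.
Proof. by rewrite -(dlen_childl R Q). Qed.

Lemma dleft_tchildl Q :
  dleft (tchildl Q) - dlen R (tchildl Q) = dleft Q - dlen R Q.
Proof.
rewrite /dleft dlen_tchildl /tchildl/= rmorphB rmorphM/=.
by field.
Qed.

Lemma dleft_tchildr Q :
  dleft (tchildr Q) - dlen R (tchildr Q) = dleft Q - dlen R Q + 3 * dlen R Q / 2.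
Proof.
rewrite /dleft dlen_tchildr /tchildr/= rmorphD rmorphM/=.
by field.
Qed.

(** Descendants of Q0 for dpar lie below Q0 or one of its two neighbours for tpar, by
    iter_tpar_near: a potential for triples gives a packing with three roots. *)
Lemma packing_tripled (A : set dyadic) (C : R) (P : dyadic -> R) :
  (forall Q, 0 <= P Q <= C * dlen R Q) ->
  (forall Q, P (tchildl Q) + P (tchildr Q) <= P Q) ->
  (forall Q, A Q -> P (tchildl Q) + P (tchildr Q) + dlen R Q <= P Q) ->
  packing A (3 * C).
Proof.
move=> P0 Pd Pc [j0 k0] X uX XA.
have root (k : int) : \sum_(Q <- X | `[< exists i, iter i tpar Q = (j0, k) >]) dlen R Q
    <= C * dlen R (j0, k0).
  rewrite -big_filter; have /andP[_] := P0 (j0, k); apply: le_trans.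
  apply: (potential_bound tpar_cases _ Pd Pc); first by move=> Q; case/andP: (P0 Q).
    exact: filter_uniq.
  by move=> Q; rewrite mem_filter => /andP[/asboolP ? /XA[]].
have := root (k0 - 1); have := root k0; have := root (k0 + 1).
set S1 := \sum_(_ <- _ | _) _ => h1; set S2 := \sum_(_ <- _ | _) _ => h2.
set S3 := \sum_(_ <- _ | _) _ => h3.
suff : \sum_(Q <- X) dlen R Q <= S1 + S2 + S3 by lra.
rewrite /S1 /S2 /S3 ![\sum_(_ <- _ | _) _]big_mkcond -!big_split/= big_seq [X in _ <= X]big_seq.
apply: ler_sum => -[j k] /XA[_ [i ei]].
have [k1] := iter_tpar_near i j k; rewrite ei/= => e k1k0.
have l0 := dlen_gt0 R (j, k).
have pos b : 0 <= if b then dlen R (j, k) else 0 by case: b => //; exact: ltW.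
have : k1 = k0 - 1 \/ k1 = k0 \/ k1 = k0 + 1 by lia.
have in_root (k' : int) : k1 = k' -> `[< exists i, iter i tpar (j, k) = (j0, k') >].
  by move=> <-; apply/asboolP; exists i.
case=> [/in_root ->|[/in_root ->|/in_root ->]].
- by rewrite -[X in X <= _]add0r lerD// addr_ge0.
- by rewrite -[X in X <= _]addr0 lerD// lerDr.
- by rewrite -addrA lerDl addr_ge0.
Qed.

Variables (I : finType) (N : R) (y : I -> R -> R).

(** The triple of Q is used because it contains the doubled interval 2Q, on which the
    approximation is finally wanted. *)
Definition flat (delta : R) (Q : dyadic) : Prop :=
  forall i (s : R), dleft Q - dlen R Q <= s <= dleft Q + 2 * dlen R Q ->
  `|y i s - y i (dleft Q) - slope y i (dleft Q) (dlen R Q) * (s - dleft Q)|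
    <= delta * N * dlen R Q.

Hypothesis N_gt0 : 0 < N.
Hypothesis y_lip : forall i s s', `|y i s - y i s'| <= N * `|s - s'|.

(** Closeness to some line over the triple of Q forces closeness to the chord of Q:
    the two slopes differ by at most 2 delta N, read off at the endpoints of Q. *)
Lemma flat_of_line (delta : R) Q (lam : I -> R) (c : I -> R) :
  (forall i (s : R), dleft Q - dlen R Q <= s <= dleft Q + 2 * dlen R Q ->
    `|y i s - c i - lam i * (s - (dleft Q - dlen R Q))| <= delta * N * dlen R Q) ->
  flat (6 * delta) Q.
Proof.
set a := dleft Q; set l := dlen R Q => line i s sQ; rewrite -/a -/l in sQ *.
have l0 : 0 < l := dlen_gt0 R Q.
have ia : a - l <= a <= a + 2 * l by apply/andP; split; lra.
have ib : a - l <= a + l <= a + 2 * l by apply/andP; split; lra.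
have ha := line i a ia; have hb := line i (a + l) ib.
have hs := line i s sQ.
set g := slope y i a l.
have eg : g - lam i = ((y i (a + l) - c i - lam i * (a + l - (a - l)))
                    - (y i a - c i - lam i * (a - (a - l)))) / l.
  by rewrite /g /slope; field; rewrite lt0r_neq0.
have hg : `|g - lam i| <= 2 * delta * N.
  rewrite eg normrM normfV (gtr0_norm l0) ler_pdivrMr//.
  by apply: le_trans (ler_normB _ _) _; lra.
have -> : y i s - y i a - g * (s - a) =
  (y i s - c i - lam i * (s - (a - l))) - (y i a - c i - lam i * (a - (a - l)))
  - (g - lam i) * (s - a) by ring.
apply: le_trans (ler_normB _ _) _.
have : `|(g - lam i) * (s - a)| <= 2 * delta * N * (2 * l).
  rewrite normrM; apply: ler_pM => //; case/andP: sQ => s1 s2.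
  by rewrite ler_norml; apply/andP; split; lra.
have := ler_normB (y i s - c i - lam i * (s - (a - l))) (y i a - c i - lam i * (a - (a - l))).
lra.
Qed.

(** The choice t = 8 / 3 delta N in deviation_le makes each of its three terms at most
    delta N |Q|. *)
Lemma flat_of_defect (delta : R) (l : nat) Q : 0 < delta -> 6 <= delta * 2 ^+ l ->
  let p := dleft Q - dlen R Q in
  let h := 3 * dlen R Q in
  defect N y p h - defect_at N y l p h <= 8 / 3 * delta ^+ 2 * N ^+ 2 * dlen R Q ->
  flat (18 * delta) Q.
Proof.
move=> d0 dl p h X; have -> : 18 * delta = 6 * (3 * delta) by ring.
have L0 : 0 < dlen R Q := dlen_gt0 R Q.
apply: (@flat_of_line _ _ (fun i => slope y i p h) (fun i => y i p)) => i s sQ.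
have h0 : 0 < h by rewrite /h mulr_gt0.
have t0 : 0 < 8 / 3 * delta * N by rewrite !mulr_gt0 ?invr_gt0.
apply: le_trans (deviation_le N_gt0 y_lip i l h0 t0 _) _.
  by case/andP: sQ => s1 s2; rewrite /p /h; apply/andP; split; lra.
have x1 : (defect N y p h - defect_at N y l p h) / (8 / 3 * delta * N) <= delta * N * dlen R Q.
  rewrite ler_pdivrMr//; apply: le_trans X _; rewrite le_eqVlt; apply/orP; left.
  by apply/eqP; ring.
have x2 : 2 * N * h / 2 ^+ l <= delta * N * dlen R Q.
  rewrite ler_pdivrMr ?exprn_gt0// /h.
  have : 0 <= N * dlen R Q * (delta * 2 ^+ l - 6).
    by rewrite !mulr_ge0 ?subr_ge0 ?(ltW N_gt0) ?(ltW L0).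
  lra.
have x3 : 8 / 3 * delta * N * h / 8 = delta * N * dlen R Q by rewrite /h; field.
by rewrite x3; lra.
Qed.

End Flat.

(** A triple that is not flat loses a fixed multiple of N ^ 2 |Q| of defect within l
    generations, while the total defect available over Q0 is at most a multiple of
    N ^ 2 |Q0|. Both sides scale with N ^ 2, so the constant does not involve N. *)
Lemma packing_not_flat (R : realType) (I : finType) (delta : R) : 0 < delta ->
  exists2 C : R, 0 <= C & forall (N : R) (y : I -> R -> R), 0 < N ->
    (forall i s s', `|y i s - y i s'| <= N * `|s - s'|) ->
    packing [set Q | ~ flat N y delta Q] C.
Proof.
move=> delta0; have [d d0 dE] : exists2 d, 0 < d & delta = 18 * d.
  by exists (delta / 18); [rewrite divr_gt0|field].
have [l dl] : exists l : nat, 6 <= d * 2 ^+ l.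
  exists (Num.truncn (6 / d)).+1; rewrite mulrC -ler_pdivrMr//.
  have := Num.Theory.truncnS_gt (6 / d); set k := (Num.truncn _).+1 => kd.
  apply: (ltW (lt_le_trans kd _)).
  by rewrite -natrX ler_nat ltnW// ltn_expl.
(* c N ^ 2 |Q| is the drop of defect over l generations allowed by flat_of_defect. *)
pose c := 8 / 3 * d ^+ 2.
have c0 : 0 < c by rewrite /c mulr_gt0 ?exprn_gt0 ?divr_gt0 ?ltr0n.
exists (3 * (l%:R * (#|I|%:R * 3) / c)).
  by rewrite !mulr_ge0// invr_ge0 ltW.
move=> N y N0 y_lip.
have N2 : 0 < N ^+ 2 by rewrite exprn_gt0.
have cN : 0 < c * N ^+ 2 by rewrite mulr_gt0.
(* Summing over l generations turns the drop of P from Q to its two children into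
   the drop of the defect over l bisections, by telescoping. *)
pose P (Q : dyadic) : R :=
  (\sum_(i < l) defect_at N y i (dleft R Q - dlen R Q) (3 * dlen R Q)) / (c * N ^+ 2).
have Pstep Q : P Q - (P (tchildl Q) + P (tchildr Q)) =
    (defect N y (dleft R Q - dlen R Q) (3 * dlen R Q)
     - defect_at N y l (dleft R Q - dlen R Q) (3 * dlen R Q)) / (c * N ^+ 2).
  rewrite /P -mulrDl -mulrBl -big_split/= dleft_tchildl dleft_tchildr.
  rewrite dlen_tchildl dlen_tchildr !mulrA.
  congr (_ / _); rewrite -sumrB; set p := _ - _; set h := 3 * _.
  rewrite -[RHS]opprB -(telescope_sumr (fun i => defect_at N y i p h) (leq0n l)) big_mkord -sumrN.
  by apply: eq_bigr => i _; rewrite opprB.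
have h3 Q : 0 < 3 * dlen R Q by rewrite mulr_gt0// dlen_gt0.
apply: (@packing_tripled _ _ _ P) => Q.
- apply/andP; split.
    by rewrite divr_ge0 ?(ltW cN)// sumr_ge0// => i _; apply: defect_at_ge0.
  rewrite /P ler_pdivrMr//.
  have -> : l%:R * (#|I|%:R * 3) / c * dlen R Q * (c * N ^+ 2)
     = \sum_(i < l) #|I|%:R * N ^+ 2 * (3 * dlen R Q).
    by rewrite sumr_const card_ord -[RHS]mulr_natl; field; rewrite lt0r_neq0.
  apply: ler_sum => i _; apply: le_trans (defect_le N y _ (h3 Q)).
  exact: defect_at_le.
- rewrite -subr_ge0 Pstep divr_ge0 ?(ltW cN)// subr_ge0.
  exact: defect_at_le.
- move=> /= nf; rewrite -lerBrDl Pstep ler_pdivlMr//.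
  rewrite leNgt; apply/negP => lt; apply: nf; rewrite dE.
  by apply: (flat_of_defect N0 y_lip d0 dl); apply: le_trans (ltW lt) _; rewrite /c; lra.
Qed.

(** * Forests built by stopping times *)

Lemma iter_dpar_scale i Q : (iter i dpar Q).1 = Q.1 + i%:Z.
Proof. by elim: i => [|i IH]; rewrite /= ?addr0// IH; lia. Qed.

Lemma ancestor_anti Q Q' : ancestor Q Q' -> ancestor Q' Q -> Q = Q'.
Proof.
move=> [i e] [[|k] e'] //.
by move: (iter_dpar_scale i Q) (iter_dpar_scale k.+1 Q'); rewrite e e'; lia.
Qed.

Lemma ancestor_par Q : ancestor Q (dpar Q).
Proof. by exists 1%N. Qed.

Lemma ancestor_refl Q : ancestor Q Q.
Proof. by exists 0%N. Qed.

Lemma ancestor_trans Q2 Q1 Q3 : ancestor Q1 Q2 -> ancestor Q2 Q3 -> ancestor Q1 Q3.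
Proof. by move=> [i <-] [k <-]; exists (k + i)%N; rewrite iterD. Qed.

Lemma dpar_neq Q : ~ ancestor (dpar Q) Q.
Proof.
move=> /(ancestor_anti (ancestor_par Q)) e.
by have := congr1 fst e; rewrite /dpar /=; lia.
Qed.

(** The dyadic intervals whose closure contains 0. Every dyadic interval has such an
    ancestor, so declaring them bad gives the stopping-time construction a place to
    start although there is no largest dyadic interval. *)
Definition central : set dyadic := [set Q | Q.2 = 0 \/ Q.2 = -1].

(** At each scale at most one central interval lies below Q0, so the lengths form a
    geometric series. *)
Lemma packing_central (R : realType) : packing central (2 : R).
Proof.
apply: (@packing_potential _ _ _ (fun Q => if `[< central Q >] then 2 * dlen R Q else 0)) => Q.
- by case: asboolP => _; rewrite ?lexx ?mulr_ge0 // ltW ?dlen_gt0.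
- have l0 := dlen_gt0 R Q.
  rewrite dlen_childl dlen_childr; do 3!case: asboolP => //;
    rewrite /central/dchildl/dchildr/=; try lia; move=> *; lra.
- have l0 := dlen_gt0 R Q.
  rewrite dlen_childl dlen_childr; do 3!case: asboolP => //;
    rewrite /central/dchildl/dchildr/=; try lia; move=> *; lra.
Qed.

Section Stopping.
Variables (B : set dyadic) (near : dyadic -> dyadic -> Prop).

(** The stopping rule asks both children at once, which is what makes every tree
    contain both or neither of the children of each of its members. *)
Definition continues (P T : dyadic) : Prop :=
  [/\ ~ B (dchildl P), ~ B (dchildr P), near (dchildl P) T & near (dchildr P) T].

(** top_of Q T: the good interval Q belongs to the tree with top T. A good interval
    opens a new tree when its parent is bad or when the tree of its parent stops there. *)
Inductive top_of : dyadic -> dyadic -> Prop :=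
| top_of_bad Q : ~ B Q -> B (dpar Q) -> top_of Q Q
| top_of_stop Q T : ~ B Q -> top_of (dpar Q) T -> ~ continues (dpar Q) T -> top_of Q Q
| top_of_next Q T : top_of (dpar Q) T -> continues (dpar Q) T -> top_of Q T.

Lemma continues_child Q T : continues (dpar Q) T -> ~ B Q /\ near Q T.
Proof. by case=> Bl Br nl nr; case: (dpar_cases Q) => ->. Qed.

Lemma top_of_good Q T : top_of Q T -> ~ B Q.
Proof. by case=> // {}Q {}T _ /continues_child[]. Qed.

Lemma top_of_top Q T : top_of Q T -> top_of T T.
Proof. by elim=> // {}Q => [*|{}T *]; [exact: top_of_bad|exact: (@top_of_stop _ T)]. Qed.

Lemma top_of_fun Q T T' : top_of Q T -> top_of Q T' -> T = T'.
Proof.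
move=> h; elim: h T' => {Q T} [Q gQ bP|Q T gQ hP IH nc|Q T hP IH c] T' h'.
- by case: Q T' / h' gQ bP => // Q T hP _ _ /(top_of_good hP).
- case: Q T' / h' gQ hP IH nc => // Q T' hP c _ _ IH nc.
  by rewrite (IH _ hP) in nc.
- case: Q T' / h' hP IH c => [Q _ bP /top_of_good //|Q T' gQ hP' nc hP IH|Q T' hP' _ _ IH _].
    by rewrite (IH _ hP').
  exact: IH.
Qed.

Lemma top_of_ancestor Q T : top_of Q T -> ancestor Q T.
Proof.
elim=> {Q T} [Q *|Q *|Q T _ + _]; [exact: ancestor_refl|exact: ancestor_refl|].
exact: ancestor_trans (ancestor_par Q).
Qed.

Lemma top_of_between Q Q' T : top_of Q T ->
  ancestor Q Q' -> ancestor Q' T -> top_of Q' T.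
Proof.
move=> h; elim: h Q' => {Q T} [Q gQ bP|Q T gQ hP IH nc|Q T hP IH c] Q' QQ' Q'T.
- by rewrite -(ancestor_anti QQ' Q'T); exact: top_of_bad.
- by rewrite -(ancestor_anti QQ' Q'T); exact: (@top_of_stop _ T).
- by case: (ancestor_cases QQ') => [<-|/IH]; [exact: top_of_next|exact].
Qed.

Lemma top_of_children Q T : top_of Q T ->
  top_of (dchildl Q) T <-> top_of (dchildr Q) T.
Proof.
have cont c Q' T' : dpar c = Q' -> top_of Q' T' -> top_of c T' -> continues Q' T'.
  move=> pc QT cT.
  by case: c T' / cT pc QT => [c _ _ <-|c T' _ _ _ <-|c T' h cc <-] // /top_of_ancestor /dpar_neq.
move=> QT; split=> h.
- apply: top_of_next; rewrite dpar_childr//; exact: cont (dpar_childl Q) QT h.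
- apply: top_of_next; rewrite dpar_childl//; exact: cont (dpar_childr Q) QT h.
Qed.

Lemma top_of_near Q T : (forall P, near P P) -> top_of Q T -> near Q T.
Proof. by move=> nearP; case=> // {}Q {}T _ /continues_child[]. Qed.

(** The distance from 0, in units of the length, strictly decreases from an interval
    to its parent until a central interval is met. *)
Lemma top_of_exists Q : central `<=` B -> ~ B Q -> exists T, top_of Q T.
Proof.
move=> ZB; have [m] := ubnP `|Q.2|%N; elim: m Q => // m IH Q Qm gQ.
have [bP|gP] := pselect (B (dpar Q)); first by exists Q; exact: top_of_bad.
have [|T hT] := IH (dpar Q) _ gP.
  have : ~ central Q by move/ZB.
  move: Qm; rewrite /central/dpar/=; lia.
have [c|nc] := pselect (continues (dpar Q) T); first by exists T; exact: top_of_next.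
by exists Q; exact: top_of_stop hT nc.
Qed.

Definition stopping_tree (T : dyadic) : set dyadic := [set Q | top_of Q T].

Definition stopping_forest : set (set dyadic) :=
  [set stopping_tree T | T in [set T | top_of T T]].

Variable R : realType.

Lemma stopping_tree_top T : top_of T T -> is_top R (stopping_tree T) T.
Proof.
by move=> TT; split=> // Q /top_of_ancestor QT; apply/dsubP.
Qed.

Lemma stopping_tree_is_tree T : top_of T T -> is_tree R (stopping_tree T).
Proof.
move=> TT; exists T; split; first exact: stopping_tree_top.
- move=> Q Q' QT /dsubP QQ' /dsubP Q'T; exact: top_of_between QT QQ' Q'T.
- by move=> Q; exact: top_of_children.
Qed.

Lemma stopping_tree_topE T : top_of T T -> tree_top R (stopping_tree T) = T.
Proof.
move=> TT; apply: (@is_top_uniq R (stopping_tree T)).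
- exact/tree_topP/stopping_tree_is_tree.
- exact: stopping_tree_top.
Qed.

Lemma stopping_coronization (C : R) : central `<=` B ->
  packing B C -> packing [set T | top_of T T] C ->
  coronization C (~` B) B stopping_forest.
Proof.
move=> ZB pB pT; split.
- exact: setUCl.
- exact: setICl.
- move=> Q0; apply: esum_le_seq => X uX XB; apply: pB => // Q /XB[BQ /dsubP QQ0].
  by split.
split.
- by move=> _ [T TT <-]; exact: stopping_tree_is_tree.
- move=> _ _ [T TT <-] [T' TT' <-] [Q [/= QT QT']].
  by rewrite (top_of_fun QT QT').
- apply/seteqP; split=> Q /=.
    move=> /(top_of_exists ZB)[T QT]; exists (stopping_tree T) => //.
    by exists T => //; exact: top_of_top QT.
  by move=> [_ [T _ <-] /top_of_good].
- move=> Q0; apply: esum_le_seq => X uX XB.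
  rewrite -(big_map (tree_top R) xpredT (dlen R)); apply: pT.
    rewrite map_inj_in_uniq// => T T' /XB[[P PP <-] _] /XB[[P' PP' <-] _].
    by rewrite !stopping_tree_topE// => ->.
  move=> _ /mapP[T /XB[[P PP <-] /dsubP + ->]]; rewrite stopping_tree_topE//.
Qed.

End Stopping.

(** * Slope control and the corona decomposition of Lipschitz maps *)

Section Corona.
Variables (R : realType) (I : finType) (N : R) (y : I -> R -> R).
Hypothesis N_gt0 : 0 < N.
Hypothesis y_lip : forall i s s', `|y i s - y i s'| <= N * `|s - s'|.

Definition dslope (i : I) (Q : dyadic) : R := slope y i (dleft R Q) (dlen R Q).

Lemma dleft_childl Q : dleft R (dchildl Q) = dleft R Q.
Proof. by rewrite /dleft dlen_childl /dchildl/= rmorphM/=; field. Qed.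

Lemma dleft_childr Q : dleft R (dchildr Q) = dleft R Q + dlen R Q / 2.
Proof. by rewrite /dleft dlen_childr /dchildr/= rmorphD rmorphM/=; field. Qed.

Lemma dslope_avg i Q :
  dslope i Q = (dslope i (dchildl Q) + dslope i (dchildr Q)) / 2.
Proof.
rewrite /dslope (@slope_double _ _ y i)// ?lt0r_neq0 ?dlen_gt0//.
by rewrite dleft_childl dleft_childr dlen_childl dlen_childr.
Qed.

Definition near_slope (kappa : R) (Q T : dyadic) : Prop :=
  forall i, `|dslope i Q - dslope i T| <= kappa * N.

(** The slope defect of Q plus the squared distance from the slope of Q to that of T.
    The squares of the slope of Q cancel, so for fixed T this is affine in the slope
    and hence additive over children (tilted_split). Replacing T by Q releases exactly
    the squared slope difference. *)
Definition tilted (T Q : dyadic) : R :=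
  \sum_i dlen R Q * (N ^+ 2 - dslope i Q ^+ 2 + (dslope i Q - dslope i T) ^+ 2).

Lemma tilted_split T Q : tilted T Q = tilted T (dchildl Q) + tilted T (dchildr Q).
Proof.
rewrite -big_split; apply: eq_bigr => i _ /=.
by rewrite dlen_childl dlen_childr dslope_avg; field.
Qed.

Lemma tilted_ge0 T Q : 0 <= tilted T Q.
Proof.
apply: sumr_ge0 => i _; rewrite mulr_ge0 ?(ltW (dlen_gt0 _ _))// addr_ge0 ?sqr_ge0//.
by rewrite subr_ge0 (slope_sqr_bound N_gt0 y_lip)// dlen_gt0.
Qed.

Lemma tilted_le T Q : tilted T Q <= 5 * #|I|%:R * N ^+ 2 * dlen R Q.
Proof.
have -> : 5 * #|I|%:R * N ^+ 2 * dlen R Q = \sum_(i : I) dlen R Q * (5 * N ^+ 2).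
  by rewrite sumr_const -mulr_natl; ring.
apply: ler_sum => i _; rewrite ler_wpM2l ?(ltW (dlen_gt0 _ _))//.
have h P : - N <= dslope i P <= N.
  by rewrite -ler_norml (slope_bound y_lip)// dlen_gt0.
have /andP[a1 a2] := h Q; have /andP[b1 b2] := h T.
set a := dslope i Q in a1 a2 *; set b := dslope i T in b1 b2 *.
by nra.
Qed.

Lemma tilted_self T Q : tilted Q Q <= tilted T Q.
Proof.
apply: ler_sum => i _; rewrite ler_wpM2l ?(ltW (dlen_gt0 _ _))//.
by rewrite subrr expr0n/= addr0 lerDl sqr_ge0.
Qed.

Lemma tilted_gain kappa T Q : 0 < kappa -> ~ near_slope kappa Q T ->
  tilted Q Q + (kappa * N) ^+ 2 * dlen R Q <= tilted T Q.
Proof.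
move=> k0 /existsNP[i /negP]; rewrite -ltNge => far.
have l0 := dlen_gt0 R Q.
rewrite /tilted (bigD1 i)//= [X in _ <= X](bigD1 i)//= -addrA [_ + (_ ^+ 2 * _)]addrC addrA.
apply: lerD; last first.
  apply: ler_sum => j _; rewrite ler_wpM2l ?(ltW l0)//.
  by rewrite subrr expr0n/= addr0 lerDl sqr_ge0.
rewrite subrr expr0n/= addr0.
have : (kappa * N) ^+ 2 <= (dslope i Q - dslope i T) ^+ 2.
  rewrite -[X in _ <= X](real_normK (num_real _)) ler_sqr ?nnegrE ?(ltW far)//.
  by rewrite mulr_ge0 ?(ltW k0) ?(ltW N_gt0).
rewrite -(ler_pM2l l0) => h; rewrite [X in _ + X]mulrC mulrDr.
by move: h; lra.
Qed.

Variables (kappa : R) (B : set dyadic).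
Hypothesis kappa_gt0 : 0 < kappa.
Local Notation top_of := (top_of B (near_slope kappa)).

(** The intervals at which a tree stops because the slope of a child has moved away
    from the slope of the top. *)
Definition turning : set dyadic := [set Q | exists2 T, top_of Q T
  & ~ near_slope kappa (dchildl Q) T \/ ~ near_slope kappa (dchildr Q) T].

(** The top of the tree of Q; the default value Q, used for bad Q, makes
    tilted (owner Q) Q the plain defect there. *)
Definition owner (Q : dyadic) : dyadic := xget Q [set T | top_of Q T].

Lemma owner_top Q T : top_of Q T -> owner Q = T.
Proof.
move=> QT; rewrite /owner; case: xgetP => [T' _ /= QT'|/(_ T)//].
exact: top_of_fun QT' QT.
Qed.

Lemma owner_par Q : owner Q = Q \/ owner Q = owner (dpar Q).
Proof.
rewrite [owner Q]/owner; case: xgetP => [T _ /= QT|_]; last by left.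
by case: Q T / QT => [Q _ _|Q T _ _ _|Q T /owner_top -> _]; [left|left|right].
Qed.

Lemma tilted_owner Q : tilted (owner Q) Q <= tilted (owner (dpar Q)) Q.
Proof. by case: (owner_par Q) => ->//; exact: tilted_self. Qed.

Lemma owner_turn Q T : top_of (dpar Q) T ->
  ~ continues B (near_slope kappa) (dpar Q) T -> owner Q = Q.
Proof.
move=> hP nc; rewrite /owner; case: xgetP => [T' _ /= QT'|//].
have gQ := top_of_good QT'.
by apply: (top_of_fun QT'); exact: top_of_stop hP nc.
Qed.

(** The potential tilted (owner Q) Q never increases from an interval to its children
    together, and at a turning interval it drops by at least (kappa N) ^ 2 |Q| / 2,
    since the child that turned starts a tree of its own. *)
Lemma packing_turning : packing turning (10 * #|I|%:R / kappa ^+ 2).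
Proof.
have N2 : 0 < (kappa * N) ^+ 2 by rewrite exprn_gt0// mulr_gt0.
(* The drop comes from one child, half as long as Q: hence the factor 2 below. *)
have split Q : tilted (owner (dpar (dchildl Q))) (dchildl Q)
    + tilted (owner (dpar (dchildr Q))) (dchildr Q) = tilted (owner Q) Q.
  by rewrite dpar_childl dpar_childr -tilted_split.
have drop Q : tilted (owner (dchildl Q)) (dchildl Q)
    + tilted (owner (dchildr Q)) (dchildr Q) <= tilted (owner Q) Q.
  by rewrite -(split Q) lerD// tilted_owner.
apply: (@packing_potential _ _ _ (fun Q => 2 / (kappa * N) ^+ 2 * tilted (owner Q) Q)) => Q.
- rewrite mulr_ge0 ?tilted_ge0 ?divr_ge0 ?(ltW N2)//=.
  have -> : 10 * #|I|%:R / kappa ^+ 2 * dlen R Q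
      = 2 / (kappa * N) ^+ 2 * (5 * #|I|%:R * N ^+ 2 * dlen R Q).
    by field; rewrite !lt0r_neq0.
  by rewrite ler_wpM2l ?tilted_le// divr_ge0// ltW.
- by rewrite -mulrDr ler_wpM2l ?divr_ge0 ?(ltW N2).
move=> [T QT turn].
have -> : dlen R Q = 2 / (kappa * N) ^+ 2 * ((kappa * N) ^+ 2 / 2 * dlen R Q).
  by field; rewrite !lt0r_neq0.
rewrite -!mulrDr ler_wpM2l ?divr_ge0 ?(ltW N2)//.
have nc : ~ continues B (near_slope kappa) Q T by case=> _ _ nl nr; case: turn.
have ol : owner (dchildl Q) = dchildl Q by apply: (@owner_turn _ T); rewrite dpar_childl.
have or : owner (dchildr Q) = dchildr Q by apply: (@owner_turn _ T); rewrite dpar_childr.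
rewrite -(split Q) dpar_childl dpar_childr ol or (owner_top QT).
have ll := dlen_childl R Q; have lr := dlen_childr R Q.
case: turn => /(tilted_gain kappa_gt0); rewrite ?ll ?lr.
  have := tilted_self T (dchildr Q); lra.
have := tilted_self T (dchildl Q); lra.
Qed.

(** The parent of a top is bad, has a bad child, or is turning. *)
Lemma packing_tops (C : R) : packing B C ->
  packing [set T | top_of T T] (5 * C + 10 * #|I|%:R / kappa ^+ 2 + 1).
Proof.
move=> pB.
have p1 := packingU (packingU (packingU pB (packing_childl pB)) (packing_childr pB))
  packing_turning.
have := packing_par p1; have -> : C + 2 * C + 2 * C = 5 * C by ring.
apply: packing_sub => T /= TT.
have key T1 T2 : top_of T1 T2 -> T1 = T2 ->
   B (dpar T1) \/ exists2 T', top_of (dpar T1) T' & ~ continues B (near_slope kappa) (dpar T1) T'.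
  case=> {T1 T2} [Q _ ? _|Q T' _ h nc _|Q T' h _ e]; [by left|by right; exists T'|].
  by move: h; rewrite -e => /top_of_ancestor /dpar_neq.
have [bP|[T' hP nc]] := key _ _ TT erefl; first by do 3!left.
apply: contrapT => /not_orP[/not_orP[/not_orP[_ bl] br] nt].
apply: nc; split => //; apply: contrapT => nn; apply: nt; exists T' => //; [by left|by right].
Qed.

End Corona.

(** The corona decomposition of Lipschitz maps of the line: along a tree, y is close,
    at the scale of each member, to lines of one common slope. The accuracy eps is
    relative to N and the packing constant depends only on eps and the number of
    coordinates. *)
Lemma lipschitz_corona (R : realType) (I : finType) (eps : R) : 0 < eps ->
  exists2 C : R, 1 <= C & forall (N : R) (y : I -> R -> R), 0 < N ->
    (forall i s s', `|y i s - y i s'| <= N * `|s - s'|) ->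
    exists (G B : set dyadic) (F : set (set dyadic)), coronization C G B F /\
      forall T, F T -> forall Q, T Q ->
        forall i (s : R), dleft R Q - dlen R Q <= s <= dleft R Q + 2 * dlen R Q ->
        `|y i s - y i (dleft R Q) - dslope y i (tree_top R T) * (s - dleft R Q)|
          <= eps * N * dlen R Q.
Proof.
move=> eps0; have e2 : 0 < eps / 2 by rewrite divr_gt0.
have e4 : 0 < eps / 4 by rewrite divr_gt0.
(* On the triple of Q one has |s - dleft Q| <= 2 |Q|, so a slope error eps / 4
   contributes as much as the flatness error eps / 2. *)
have [C0 C00 pflat] := packing_not_flat I e2.
set D := 10 * #|I|%:R / (eps / 4) ^+ 2.
have D0 : 0 <= D by apply: divr_ge0; [rewrite mulr_ge0 ?ler0n|rewrite exprn_ge0 ?(ltW e4)].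
exists (5 * (2 + C0) + D + 1); first by lra.
move=> N y N0 y_lip.
pose B : set dyadic := central `|` [set Q | ~ flat N y (eps / 2) Q].
pose near := near_slope N y (eps / 4).
have pB : packing B (2 + C0) by apply: packingU; [exact: packing_central|exact: pflat].
exists (~` B), B, (stopping_forest B near); split.
  apply: stopping_coronization; first by move=> Q; left.
    move=> Q0 X uX XA; apply: le_trans (pB Q0 X uX XA) _.
    by rewrite ler_wpM2r ?(ltW (dlen_gt0 _ _))//; lra.
  exact: packing_tops.
move=> _ [T TT <-] Q QT i s sQ; rewrite stopping_tree_topE//.
have l0 := dlen_gt0 R Q.
have /not_orP[_ /contrapT flatQ] := top_of_good QT.
have nearP P : near P P by move=> j; rewrite subrr normr0 mulr_ge0 ?(ltW e4) ?(ltW N0).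
have nQT : near Q T := top_of_near nearP QT.
have h1 := flatQ i s sQ; have h2 := nQT i; move: h1; rewrite -/(dslope y i Q) => h1.
set a := dleft R Q in sQ h1 *; set l := dlen R Q in sQ l0 h1 *.
have -> : y i s - y i a - dslope y i T * (s - a) =
  (y i s - y i a - dslope y i Q * (s - a)) + (dslope y i Q - dslope y i T) * (s - a) by ring.
apply: le_trans (ler_normD _ _) _.
have : `|(dslope y i Q - dslope y i T) * (s - a)| <= (eps / 4 * N) * (2 * l).
  case/andP: sQ => s1 s2.
  by rewrite normrM; apply: ler_pM => //; rewrite ler_norml; apply/andP; split; lra.
lra.
Qed.

(** * Intrinsic graphs in coordinates *)

Section Enorm.
Variables (R : realType) (m : nat).
Implicit Types x : 'rV[R]_m.

Lemma enorm_ge_coord x j : `|x 0 j| <= enorm x.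
Proof.
rewrite -sqrtr_sqr ler_sqrt (bigD1 j)//= ?lerDl ?addr_ge0 ?sqr_ge0//;
  by apply: sumr_ge0 => k _; rewrite sqr_ge0.
Qed.

Lemma enorm_le x c : (0 < m)%N -> (forall j, `|x 0 j| <= c) -> enorm x <= m%:R * c.
Proof.
move=> m0 xc; have c0 : 0 <= c by apply: le_trans (xc (Ordinal m0)).
have mc : 0 <= m%:R * c by rewrite mulr_ge0.
rewrite -(ger0_norm mc) -sqrtr_sqr ler_sqrt ?sqr_ge0//.
apply: (@le_trans _ _ (\sum_(i < m) c ^+ 2)).
  by apply: ler_sum => j _; rewrite -(real_normK (num_real (x 0 j))) ler_sqr ?nnegrE.
rewrite sumr_const card_ord -[leLHS]mulr_natl exprMn ler_wpM2r ?sqr_ge0//.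
by rewrite -natrX ler_nat leq_pmull.
Qed.

End Enorm.

Section Geometry.
Variables (R : realType) (n : nat).
Hypothesis n_gt0 : (0 < n)%N.
Local Notation m := (n + n).-1.
Implicit Types (x : 'rV[R]_(n + n)) (u v w : 'rV[R]_m).

(** The standard symplectic form, so that the group law adds half of it to the sum of
    the last coordinates. *)
Definition symp (x x' : 'rV[R]_(n + n)) : R :=
  \sum_(i < n) (x 0 (lshift n i) * x' 0 (rshift n i)
              - x' 0 (lshift n i) * x 0 (rshift n i)).

Lemma hmulE (p q : heis R n) :
  hmul p q = (p.1 + q.1, p.2 + q.2 + 2^-1 * symp p.1 q.1).
Proof. by []. Qed.

Lemma sympDl x1 x2 x : symp (x1 + x2) x = symp x1 x + symp x2 x.
Proof. by rewrite -big_split; apply: eq_bigr => i _; rewrite /= !mxE; ring. Qed.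

Lemma sympZl a x1 x : symp (a *: x1) x = a * symp x1 x.
Proof. by rewrite mulr_sumr; apply: eq_bigr => i _; rewrite /= !mxE; ring. Qed.

Lemma symp_anti x x' : symp x x' = - symp x' x.
Proof. by rewrite -sumrN; apply: eq_bigr => i _; rewrite opprB. Qed.

Lemma sympNl x1 x : symp (- x1) x = - symp x1 x.
Proof. by rewrite -scaleN1r sympZl mulN1r. Qed.

Lemma sympDr x x1 x2 : symp x (x1 + x2) = symp x x1 + symp x x2.
Proof. by rewrite symp_anti sympDl opprD -!symp_anti. Qed.

Lemma sympZr a x x1 : symp x (a *: x1) = a * symp x x1.
Proof. by rewrite symp_anti sympZl -mulrN -symp_anti. Qed.

Lemma symp_bound x x' a b : (forall i, `|x 0 i| <= a) -> (forall i, `|x' 0 i| <= b) ->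
  `|symp x x'| <= 2 * n%:R * a * b.
Proof.
move=> xa xb; apply: le_trans (ler_norm_sum _ _ _) _.
apply: (@le_trans _ _ (\sum_(i < n) 2 * a * b)); last first.
  by rewrite sumr_const card_ord -[leLHS]mulr_natl !mulrA [_ * 2]mulrC.
apply: ler_sum => i _; apply: le_trans (ler_normB _ _) _.
rewrite !normrM -mulrA mulr_natl mulr2n lerD//; first by apply: ler_pM.
by rewrite mulrC; apply: ler_pM.
Qed.

Lemma sympNr x x1 : symp x (- x1) = - symp x x1.
Proof. by rewrite -scaleN1r sympZr mulN1r. Qed.

Definition emb u : 'rV[R]_(n + n) := (of_W (u, 0 : R)).1.

Lemma of_W_emb (w : vert R n) : of_W w = (emb w.1, w.2).
Proof. by []. Qed.

Lemma embD u v : emb (u + v) = emb u + emb v.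
Proof.
by apply/rowP => i; rewrite !mxE -big_split; apply: eq_bigr => j _; rewrite /= mxE.
Qed.

Lemma embZ a u : emb (a *: u) = a *: emb u.
Proof.
by apply/rowP => i; rewrite !mxE mulr_sumr; apply: eq_bigr => j _; rewrite /= mxE.
Qed.

Lemma embN u : emb (- u) = - emb u.
Proof. by rewrite -scaleN1r embZ scaleN1r. Qed.

Lemma emb_cases u (i : 'I_(n + n)) :
  (i = 0%N :> nat /\ emb u 0 i = 0) \/
  exists2 j : 'I_m, i = j.+1 :> nat & emb u 0 i = u 0 j.
Proof.
case: (posnP i) => i0; [left|right]; first by rewrite of_W0.
have im : (i.-1 < m)%N by have := ltn_ord i; lia.
have ij : i = (Ordinal im).+1 :> nat by rewrite /= prednK.
by exists (Ordinal im) => //; rewrite (of_WS _ ij).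
Qed.

Lemma emb_bound u a i : (0 : R) <= a -> (forall j, `|u 0 j| <= a) -> `|emb u 0 i| <= a.
Proof. by move=> a0 ua; case: (emb_cases u i) => [[_ ->]|[j _ ->]//]; rewrite normr0. Qed.

Lemma enorm_emb u : enorm (emb u) = enorm u.
Proof.
congr Num.sqrt; have e : (m.+1 = n + n)%N by lia.
rewrite (reindex (cast_ord e)) /=; last first.
  by exists (cast_ord (esym e)) => i _; [exact: cast_ordK|exact: cast_ordKV].
rewrite big_ord_recl of_W0// expr0n add0r; apply: eq_bigr => j _.
by rewrite (@of_WS _ _ _ _ j).
Qed.

Lemma conj_subproof : (n.-1 < m)%N.
Proof. by lia. Qed.

(** The coordinate x_(n+1), conjugate to x_1, counted among x_2, ..., x_2n. *)
Definition conj_coord : 'I_m := Ordinal conj_subproof.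
Local Notation q := conj_coord.

Definition e1 : 'rV[R]_(n + n) := (of_V n (1 : R)).1.

Lemma of_VE (s : R) : of_V n s = (s *: e1, 0).
Proof.
apply: heis_eq => //=; apply/rowP => i; rewrite !mxE.
by case: eqP => _; rewrite ?mulr1 ?mulr0.
Qed.

Lemma symp_axis u : symp e1 (emb u) = u 0 q.
Proof.
pose i0 := Ordinal n_gt0.
rewrite /symp (bigD1 i0)//= big1 ?addr0 => [|i ii0]; last first.
  have i1 : (0 < i)%N by rewrite lt0n; apply: contraNneq ii0 => e; apply/eqP/val_inj.
  by rewrite !mxE /= eqn0Ngt i1 /= eqn0Ngt addn_gt0 n_gt0 mul0r mulr0 subrr.
rewrite [e1 _ _]mxE/= mul1r [e1 _ _]mxE/= addn0 eqn0Ngt n_gt0 mulr0 subr0.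
by rewrite (@of_WS _ _ _ _ q)//= addn0 prednK.
Qed.

Lemma symp_axis_axis : symp e1 e1 = 0.
Proof. by rewrite /symp big1// => i _; rewrite subrr. Qed.

Definition omega u v : R := symp (emb u) (emb v).

Lemma omegaDl u v w : omega (u + v) w = omega u w + omega v w.
Proof. by rewrite /omega embD sympDl. Qed.
Lemma omegaDr u v w : omega u (v + w) = omega u v + omega u w.
Proof. by rewrite /omega embD sympDr. Qed.
Lemma omegaZl a u v : omega (a *: u) v = a * omega u v.
Proof. by rewrite /omega embZ sympZl. Qed.
Lemma omegaZr a u v : omega u (a *: v) = a * omega u v.
Proof. by rewrite /omega embZ sympZr. Qed.
Lemma omega_anti u v : omega u v = - omega v u.
Proof. exact: symp_anti. Qed.
Lemma omegaNl u v : omega (- u) v = - omega u v.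
Proof. by rewrite -scaleN1r omegaZl mulN1r. Qed.
Lemma omegaNr u v : omega u (- v) = - omega u v.
Proof. by rewrite -scaleN1r omegaZr mulN1r. Qed.
Lemma omega_self u : omega u u = 0.
Proof. by have := omega_anti u u; lra. Qed.

Lemma omega_bound u v a b : 0 <= a -> 0 <= b ->
  (forall j, `|u 0 j| <= a) -> (forall j, `|v 0 j| <= b) ->
  `|omega u v| <= 2 * n%:R * a * b.
Proof. by move=> a0 b0 ua vb; apply: symp_bound => i; exact: emb_bound. Qed.

Definition conj_dir : 'rV[R]_m := delta_mx 0 q.

Lemma conj_dirE j : conj_dir 0 j = (j == q)%:R.
Proof. by rewrite mxE eqxx. Qed.

(** The partner of x_(n+1) in the symplectic form is x_1, which vanishes on W.
    Displacements of a curve along x_(n+1) are therefore invisible to omega. *)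
Lemma omega_conj_dir u : omega u conj_dir = 0.
Proof.
rewrite /omega /symp big1// => i _.
have d0 (k : 'I_(n + n)) : k != n :> nat -> emb conj_dir 0 k = 0.
  move=> kn; case: (emb_cases conj_dir k) => [[]//|[j kj ->]]; rewrite conj_dirE.
  by case: eqP => // jq; move: kn; rewrite kj jq /= prednK// eqxx.
rewrite [X in _ - X * _]d0/=; last by rewrite ltn_eqF.
rewrite mul0r subr0; have [i0|i0] := posnP i.
  by rewrite of_W0// mul0r.
by rewrite d0 ?mulr0//=; apply/eqP; lia.
Qed.

(** The last coordinate of the W-component of the difference of two graph points, see
    graph_diff. Its vanishing to second order says that the graph is horizontal: t then
    has derivative - x_(n+1) plus half the area swept by the other coordinates. *)
Definition horizontal_defect (phi : R -> vert R n) (s s' : R) : R :=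
  (phi s').2 - (phi s).2 + (s' - s) * (phi s).1 0 q - 2^-1 * omega (phi s).1 (phi s').1.

(** The last coordinate of w'^-1 * w in the Heisenberg group. *)
Definition vdiff (w w' : vert R n) : R := w.2 - w'.2 - 2^-1 * omega w'.1 w.1.

Lemma hdist_of_W (w w' : vert R n) :
  hdist (of_W w) (of_W w') = Num.max (enorm (w.1 - w'.1)) (Num.sqrt `|vdiff w w'|).
Proof.
rewrite /hdist /hnorm hmulE !of_W_emb /hinv /= sympNl -/(omega _ _).
rewrite -embN -embD enorm_emb [- _ + _]addrC; congr (Num.max _ (Num.sqrt `|_|)).
by rewrite /vdiff; ring.
Qed.

Lemma graph_diff (phi : R -> vert R n) (s s' : R) :
  hmul (hinv (graph_map phi s)) (graph_map phi s') =
  hmul (of_V n (s' - s)) (of_W ((phi s').1 - (phi s).1, horizontal_defect phi s s')).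
Proof.
rewrite /graph_map !of_VE !of_W_emb !hmulE /hinv /=; apply: heis_eq => /=.
  rewrite embD embN; move: (emb _) (emb _) e1 => a b c.
  by apply/rowP => i; rewrite !mxE; ring.
rewrite embD embN !(sympNl, sympNr, sympDl, sympDr, sympZl, sympZr).
rewrite (symp_anti (emb _) e1) !symp_axis symp_axis_axis /horizontal_defect /omega.
by field.
Qed.

Lemma hnorm_of_V (s : R) : hnorm (of_V n s) = `|s|.
Proof.
rewrite /hnorm /= normr0 sqrtr0.
have -> : enorm (of_V n s).1 = `|s|.
  have i0P : (0 < n + n)%N by rewrite addn_gt0 n_gt0.
  rewrite -sqrtr_sqr; congr Num.sqrt; rewrite (bigD1 (Ordinal i0P))//=.
  rewrite mxE/= big1 ?addr0// => i ii0.
  rewrite mxE; case: eqP => [e|_]; last by rewrite expr0n.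
  by case/eqP: ii0; apply: val_inj.
by apply: max_idPl.
Qed.

Lemma intrinsic_lipschitz_withE (L : R) (phi : R -> vert R n) :
  intrinsic_lipschitz_with L phi <->
  forall s s', enorm ((phi s').1 - (phi s).1) <= L * `|s' - s|
    /\ Num.sqrt `|horizontal_defect phi s s'| <= L * `|s' - s|.
Proof.
rewrite /intrinsic_lipschitz_with.
have e s s' : (hnorm (pi_W (hmul (hinv (graph_map phi s)) (graph_map phi s')))
   <= L * hnorm (pi_V (hmul (hinv (graph_map phi s)) (graph_map phi s')))) =
   (enorm ((phi s').1 - (phi s).1) <= L * `|s' - s|)
    && (Num.sqrt `|horizontal_defect phi s s'| <= L * `|s' - s|).
  rewrite graph_diff.
  have [-> ->] := pi_uniq (s' - s) ((phi s').1 - (phi s).1, horizontal_defect phi s s').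
  by rewrite hnorm_of_V /hnorm ge_max of_W_emb /= enorm_emb.
split=> [h s s'|h s' s /=]; first by have := h s' s; rewrite /= e => /andP[].
by rewrite e; apply/andP; exact: h.
Qed.

Lemma sqrt_le (a b : R) : 0 <= b -> (Num.sqrt `|a| <= b) = (`|a| <= b ^+ 2).
Proof. by move=> b0; rewrite -{1}(ger0_norm b0) -(sqrtr_sqr b) ler_sqrt ?sqr_ge0. Qed.

Lemma intrinsic_lipschitz_hdef (L : R) (phi : R -> vert R n) s s' : 0 <= L ->
  intrinsic_lipschitz_with L phi -> `|horizontal_defect phi s s'| <= L ^+ 2 * (s' - s) ^+ 2.
Proof.
move=> L0 /intrinsic_lipschitz_withE /(_ s s')[_]; rewrite sqrt_le ?mulr_ge0//.
by rewrite exprMn (real_normK (num_real _)).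
Qed.

Lemma intrinsic_lipschitz_coord (L : R) (phi : R -> vert R n) : intrinsic_lipschitz_with L phi ->
  forall j s s', `|(phi s).1 0 j - (phi s').1 0 j| <= L * `|s - s'|.
Proof.
move=> /intrinsic_lipschitz_withE h j s s'; have [+ _] := h s' s.
by apply: le_trans; apply: le_trans (enorm_ge_coord _ j); rewrite !mxE.
Qed.

Lemma hdef_intrinsic_lipschitz (A M : R) (phi : R -> vert R n) : 0 <= A -> 0 <= M ->
  (forall j s s', `|(phi s).1 0 j - (phi s').1 0 j| <= A * `|s - s'|) ->
  (forall s s', `|horizontal_defect phi s s'| <= M * (s' - s) ^+ 2) ->
  intrinsic_lipschitz phi.
Proof.
move=> A0 M0 lip hd; have mA : 0 <= m%:R * A by rewrite mulr_ge0.
exists (m%:R * A + M + 1); first by rewrite !addr_ge0.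
apply/intrinsic_lipschitz_withE => s s'; split.
  apply: (@le_trans _ _ (m%:R * (A * `|s' - s|))); last first.
    by rewrite mulrA ler_wpM2r// -addrA lerDl addr_ge0.
  by apply: enorm_le => [|j]; [lia|rewrite !mxE; exact: lip].
rewrite sqrt_le ?mulr_ge0 ?addr_ge0//; apply: le_trans (hd s s') _.
rewrite exprMn (real_normK (num_real _)) ler_wpM2r ?sqr_ge0//.
set a := m%:R * A in mA *; nra.
Qed.

End Geometry.

(** * The cocycle identity for horizontality *)

Section Calculus.
Variables (R : realType).

(** An error quadratic in the step disappears under repeated bisection. This stands in
    for the integration of the almost everywhere defined derivative. *)
Lemma near_linear_increment (f : R -> R) (a b B C : R) : a <= b -> 0 <= C ->
  (forall s s', a <= s -> s <= s' -> s' <= b ->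
     `|f s' - f s| <= B * (s' - s) + C * (s' - s) ^+ 2) ->
  `|f b - f a| <= B * (b - a).
Proof.
move=> ab C0 h.
have step k : forall s s', a <= s -> s <= s' -> s' <= b ->
     `|f s' - f s| <= B * (s' - s) + C * (s' - s) ^+ 2 / 2 ^+ k.
  elim: k => [|k IH] s s' as_ ss' s'b; first by rewrite expr0 divr1 h.
  pose z := (s + s') / 2.
  have sz : s <= z by rewrite /z; lra.
  have zs' : z <= s' by rewrite /z; lra.
  have h1 := IH s z as_ sz ltac:(lra).
  have h2 := IH z s' ltac:(lra) zs' s'b.
  have -> : f s' - f s = (f s' - f z) + (f z - f s) by ring.
  apply: le_trans (ler_normD _ _) _; apply: le_trans (lerD h2 h1) _.
  rewrite le_eqVlt; apply/orP; left; apply/eqP; rewrite /z [2 ^+ k.+1]exprS.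
  by field; rewrite expf_neq0// pnatr_eq0.
rewrite -subr_ge0 leNgt; apply/negP => neg.
pose e := `|f b - f a| - B * (b - a).
have e0 : 0 < e by rewrite /e; lra.
pose c := C * (b - a) ^+ 2; have c0 : 0 <= c by rewrite mulr_ge0 ?sqr_ge0.
pose k := (Num.truncn (c / e)).+1.
have := step k a b (lexx _) ab (lexx _).
rewrite -/c; suff : c / 2 ^+ k < e by rewrite /e; lra.
rewrite ltr_pdivrMr ?exprn_gt0// mulrC -ltr_pdivrMr//.
apply: lt_le_trans (Num.Theory.truncnS_gt _) _.
by rewrite -natrX ler_nat ltnW// ltn_expl.
Qed.

Variable (n : nat).
Hypothesis n_gt0 : (0 < n)%N.
Local Notation m := (n + n).-1.
Local Notation q := (conj_coord n_gt0).
Local Notation om := (@omega R n).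
Local Notation hdef := (horizontal_defect n_gt0).
Implicit Types (phi : R -> vert R n).

(** Horizontality is additive up to the area of the triangle spanned by three points. *)
Lemma hdef_chain phi s1 s2 s3 :
  hdef phi s1 s3 = hdef phi s1 s2 + hdef phi s2 s3
    + (s3 - s2) * ((phi s1).1 0 q - (phi s2).1 0 q)
    - 2^-1 * om ((phi s1).1 - (phi s2).1) ((phi s3).1 - (phi s2).1).
Proof.
rewrite /hdef !(omegaDl, omegaDr, omegaNl, omegaNr) omega_self.
by ring.
Qed.

Lemma hdef_swap phi s s' :
  hdef phi s' s = - hdef phi s s' + (s' - s) * ((phi s).1 0 q - (phi s').1 0 q).
Proof. by rewrite /hdef (omega_anti (phi s').1); ring. Qed.

Section Tame.
Variables (sigma : 'rV[R]_m) (kappa M : R).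

(** Quantitative control of a pair of parameters: the increment is that of a line of
    slope sigma up to relative error kappa, and the graph is horizontal to second order. *)
Definition tame phi (s s' : R) : Prop :=
  [/\ s <= s',
      forall j, `|(phi s').1 0 j - (phi s).1 0 j - sigma 0 j * (s' - s)| <= kappa * (s' - s)
    & `|hdef phi s s'| <= M * (s' - s) ^+ 2].

Variable A : R.
Hypotheses (A_ge0 : 0 <= A) (sigmaA : forall j, `|sigma 0 j| + kappa <= A)
  (M_large : A + n%:R * A ^+ 2 <= M).

Lemma tame_lip phi s s' j : tame phi s s' -> `|(phi s').1 0 j - (phi s).1 0 j| <= A * (s' - s).
Proof.
move=> [ss' h _].
have -> : (phi s').1 0 j - (phi s).1 0 j =
  ((phi s').1 0 j - (phi s).1 0 j - sigma 0 j * (s' - s)) + sigma 0 j * (s' - s) by ring.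
apply: le_trans (ler_normD _ _) _; apply: le_trans (lerD (h j) (lexx _)) _.
by rewrite normrM (@ger0_norm _ (s' - s)) ?subr_ge0// -mulrDl addrC ler_wpM2r ?subr_ge0.
Qed.

(** The area term of hdef_chain is at most (A + n A ^ 2) times the product of the two
    steps, which fits in the cross term of M (s3 - s1) ^ 2 once M exceeds that constant.
    So M is not lost when pairs are chained, and gluing keeps it. *)
Lemma tame_trans phi s1 s2 s3 : tame phi s1 s2 -> tame phi s2 s3 -> tame phi s1 s3.
Proof.
move=> t1 t2; have [s12 h12 d12] := t1; have [s23 h23 d23] := t2; split.
- exact: le_trans s12 s23.
- move=> j; have := h12 j; have := h23 j => a2 a1.
  have -> : (phi s3).1 0 j - (phi s1).1 0 j - sigma 0 j * (s3 - s1) =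
    ((phi s3).1 0 j - (phi s2).1 0 j - sigma 0 j * (s3 - s2))
    + ((phi s2).1 0 j - (phi s1).1 0 j - sigma 0 j * (s2 - s1)) by ring.
  by apply: le_trans (ler_normD _ _) _; lra.
have x0 : 0 <= s2 - s1 by rewrite subr_ge0.
have y0 : 0 <= s3 - s2 by rewrite subr_ge0.
have l1 : `|(s3 - s2) * ((phi s1).1 0 q - (phi s2).1 0 q)| <= A * (s2 - s1) * (s3 - s2).
  rewrite normrM (ger0_norm y0) mulrC ler_wpM2r// distrC.
  exact: tame_lip.
have l2 : `|2^-1 * om ((phi s1).1 - (phi s2).1) ((phi s3).1 - (phi s2).1)|
    <= n%:R * A ^+ 2 * (s2 - s1) * (s3 - s2).
  have : `|om ((phi s1).1 - (phi s2).1) ((phi s3).1 - (phi s2).1)|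
     <= 2 * n%:R * (A * (s2 - s1)) * (A * (s3 - s2)).
    apply: (omega_bound n_gt0) => [||j|j]; [by rewrite mulr_ge0|by rewrite mulr_ge0| |].
      by rewrite !mxE distrC; exact: tame_lip.
    by rewrite !mxE; exact: tame_lip.
  by rewrite normrM ger0_norm ?invr_ge0//; lra.
rewrite (hdef_chain _ s1 s2 s3).
have tri (a b c d : R) : `|a + b + c - d| <= `|a| + `|b| + `|c| + `|d|.
  apply: le_trans (ler_normB _ _) _; rewrite lerD2r.
  apply: le_trans (ler_normD _ _) _; rewrite lerD2r; exact: ler_normD.
apply: le_trans (tri _ _ _ _) _.
have M0 : 0 <= M by apply: le_trans M_large; rewrite addr_ge0// mulr_ge0 ?sqr_ge0.
have xy0 : 0 <= (s2 - s1) * (s3 - s2) by rewrite mulr_ge0.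
have cross : (A + n%:R * A ^+ 2) * ((s2 - s1) * (s3 - s2)) <= M * ((s2 - s1) * (s3 - s2)).
  by rewrite ler_wpM2r.
have Mxy : 0 <= M * ((s2 - s1) * (s3 - s2)) by rewrite mulr_ge0.
have -> : (s3 - s1) ^+ 2 = (s2 - s1) ^+ 2 + (s3 - s2) ^+ 2 + 2 * ((s2 - s1) * (s3 - s2)) by ring.
lra.
Qed.

Lemma tame_intrinsic_lipschitz phi :
  (forall s s', s < s' -> tame phi s s') -> intrinsic_lipschitz phi.
Proof.
move=> h; have M0 : 0 <= M by apply: le_trans M_large; rewrite addr_ge0// mulr_ge0 ?sqr_ge0.
have lip j s s' : `|(phi s).1 0 j - (phi s').1 0 j| <= A * `|s - s'|.
  case: (ltgtP s s') => [lt|gt|->]; last by rewrite !subrr normr0 mulr0.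
    by rewrite distrC (distrC s) (@gtr0_norm _ (s' - s)) ?subr_gt0//; exact: tame_lip (h _ _ lt).
  by rewrite (@gtr0_norm _ (s - s')) ?subr_gt0//; exact: tame_lip (h _ _ gt).
apply: (@hdef_intrinsic_lipschitz _ _ n_gt0 A (M + A)) => //; first exact: addr_ge0.
move=> s s'; case: (ltgtP s s') => [lt|gt|->].
- have [_ _ d] := h _ _ lt; apply: le_trans d _.
  by rewrite ler_wpM2r ?sqr_ge0// lerDl.
- rewrite hdef_swap; apply: le_trans (ler_normD _ _) _; rewrite normrN [(M + A) * _]mulrDl.
  have [_ _ d] := h _ _ gt; apply: lerD; first by rewrite -sqrrN opprB.
  rewrite -(real_normK (num_real (s' - s))) expr2 normrM (distrC s s') mulrCA.
  by rewrite ler_wpM2l.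
- by rewrite /hdef omega_self !subrr mul0r mulr0 addr0 subr0 normr0 expr0n mulr0.
Qed.

End Tame.

End Calculus.

(** * Comparison of horizontal curves and explicit arcs *)

Section Comparison.
Variables (R : realType) (n : nat).
Hypothesis n_gt0 : (0 < n)%N.
Local Notation m := (n + n).-1.
Local Notation q := (conj_coord n_gt0).
Local Notation om := (@omega R n).
Local Notation hdef := (horizontal_defect n_gt0).
Implicit Types (phi psi : R -> vert R n).

(** Every term is either horizontal defect, or carries the factor phi - psi, or is
    quadratic in the step. *)
Lemma vdiff_step phi psi (s s' : R) :
  vdiff (phi s') (psi s') - vdiff (phi s) (psi s) =
  hdef phi s s' - hdef psi s s'
  - (s' - s) * ((phi s).1 0 q - (psi s).1 0 q)
  + 2^-1 * (om ((phi s).1 - (psi s).1)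
               (((phi s').1 - (phi s).1) + ((psi s').1 - (psi s).1))
            - om ((psi s').1 - (psi s).1) ((phi s').1 - (phi s).1)).
Proof.
rewrite /vdiff /hdef !(omegaDl, omegaDr, omegaNl, omegaNr) !omega_self.
rewrite (omega_anti (phi s).1 (psi s').1) (omega_anti (phi s).1 (psi s).1).
by field.
Qed.

(** Two horizontal curves that stay E-close in the W-coordinates separate in the last
    coordinate at a speed proportional to E: the quadratic terms of vdiff_step are removed by
    near_linear_increment. *)
Lemma vdiff_drift phi psi (A M E a b : R) : a <= b -> 0 <= A -> 0 <= M -> 0 <= E ->
  (forall s s' j, a <= s -> s <= s' -> s' <= b ->
    `|(phi s').1 0 j - (phi s).1 0 j| <= A * (s' - s)) ->
  (forall s s' j, a <= s -> s <= s' -> s' <= b ->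
    `|(psi s').1 0 j - (psi s).1 0 j| <= A * (s' - s)) ->
  (forall s s', a <= s -> s <= s' -> s' <= b -> `|hdef phi s s'| <= M * (s' - s) ^+ 2) ->
  (forall s s', a <= s -> s <= s' -> s' <= b -> `|hdef psi s s'| <= M * (s' - s) ^+ 2) ->
  (forall s j, a <= s -> s <= b -> `|(phi s).1 0 j - (psi s).1 0 j| <= E) ->
  `|vdiff (phi b) (psi b) - vdiff (phi a) (psi a)| <= (E + 2 * n%:R * E * A) * (b - a).
Proof.
move=> ab A0 M0 E0 lphi lpsi hphi hpsi close.
apply: (@near_linear_increment _ (fun s => vdiff (phi s) (psi s)) _ _ _
  (2 * M + n%:R * A ^+ 2)) => //.
  by rewrite addr_ge0 ?mulr_ge0 ?sqr_ge0.
move=> s s' as_ ss' s'b; rewrite vdiff_step.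
have d0 : 0 <= s' - s by rewrite subr_ge0.
have sb : s <= b := le_trans ss' s'b.
have h1 := hphi s s' as_ ss' s'b; have h2 := hpsi s s' as_ ss' s'b.
have h3 : `|(s' - s) * ((phi s).1 0 q - (psi s).1 0 q)| <= E * (s' - s).
  by rewrite normrM (ger0_norm d0) mulrC ler_wpM2r// close.
have h4 : `|om ((phi s).1 - (psi s).1)
               (((phi s').1 - (phi s).1) + ((psi s').1 - (psi s).1))|
      <= 2 * n%:R * E * (2 * (A * (s' - s))).
  apply: (omega_bound n_gt0) => [//||j|j]; first by rewrite !mulr_ge0.
    by rewrite !mxE close.
  rewrite !mxE mulr_natl mulr2n; apply: le_trans (ler_normD _ _) _.
  by rewrite lerD ?lphi ?lpsi.
have h5 : `|om ((psi s').1 - (psi s).1) ((phi s').1 - (phi s).1)|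
    <= 2 * n%:R * (A * (s' - s)) * (A * (s' - s)).
  apply: (omega_bound n_gt0) => [||j|j]; rewrite ?mulr_ge0//.
    by rewrite !mxE lpsi.
  by rewrite !mxE lphi.
move: h1 h2 h3 h4 h5.
move: (hdef phi s s') (hdef psi s s') (_ * (_ - _)) (om _ (_ + _)) (om _ _) => u v w x z.
rewrite !ler_norml => /andP[? ?] /andP[? ?] /andP[? ?] /andP[? ?] /andP[? ?].
by apply/andP; split; lra.
Qed.

(** The horizontal curve starting at w whose W-coordinates are a line of slope tau plus
    a parabola c u (l - u) in the direction x_(n+1). The last coordinate is the explicit
    primitive; by omega_conj_dir the parabola enters it only through its integral. *)
Definition harc (a l c : R) (w : vert R n) (tau : 'rV[R]_m) (s : R) : vert R n :=
  let u := s - a in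
  (w.1 + u *: tau + (c * u * (l - u)) *: conj_dir R n_gt0,
   w.2 - u * w.1 0 q - 2^-1 * tau 0 q * u ^+ 2
   - c * (l * u ^+ 2 / 2 - u ^+ 3 / 3) + 2^-1 * u * om w.1 tau).

Lemma harc1E a l c w tau s j : (harc a l c w tau s).1 0 j =
  w.1 0 j + (s - a) * tau 0 j + c * (s - a) * (l - (s - a)) * (j == q)%:R.
Proof. by rewrite /harc /= !mxE eqxx. Qed.

Lemma harc_start a l c w tau : harc a l c w tau a = w.
Proof.
case: w => w t; rewrite /harc /= subrr !(mulr0, mul0r, scale0r, addr0, expr0n)/=.
by rewrite !(mul0r, subr0, mulr0, addr0).
Qed.

Lemma hdef_harc a l c w tau s s' :
  hdef (harc a l c w tau) s s' =
  - 2^-1 * tau 0 q * (s' - s) ^+ 2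
  - c * ((l - 2 * (s - a)) * (s' - s) ^+ 2 / 2 - (s' - s) ^+ 3 / 3).
Proof.
have omq u : om (conj_dir R n_gt0) u = 0 by rewrite omega_anti omega_conj_dir oppr0.
rewrite /hdef harc1E eqxx /harc /= !(omegaDl, omegaDr, omegaZl, omegaZr).
rewrite !omq !omega_conj_dir !omega_self (omega_anti tau w.1).
by field.
Qed.

Lemma hdef_harc_bound (a l c : R) w tau (s s' : R) : s <= s' ->
  (c = 0 \/ a <= s /\ s' <= a + l) ->
  `|hdef (harc a l c w tau) s s'| <= (`|tau 0 q| + `|c| * `|l|) * (s' - s) ^+ 2.
Proof.
move=> ss' cl; rewrite hdef_harc.
have d0 : 0 <= (s' - s) ^+ 2 by rewrite sqr_ge0.
have h1 : `|- 2^-1 * tau 0 q * (s' - s) ^+ 2| <= `|tau 0 q| * (s' - s) ^+ 2.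
  rewrite normrM (ger0_norm d0) ler_wpM2r// normrM normrN (@ger0_norm _ 2^-1) ?invr_ge0//.
  by rewrite ler_piMl//; lra.
apply: le_trans (ler_normB _ _) _; rewrite [leRHS]mulrDl lerD//.
case: cl => [->|[as_ sl]]; first by rewrite !(normr0, mul0r).
rewrite normrM -[leRHS]mulrA ler_wpM2l//.
have -> : (l - 2 * (s - a)) * (s' - s) ^+ 2 / 2 - (s' - s) ^+ 3 / 3
  = (l / 2 - (s - a) - (s' - s) / 3) * (s' - s) ^+ 2 by field.
rewrite normrM (ger0_norm d0) ler_wpM2r//.
have l0 : 0 <= l by lra.
by rewrite (ger0_norm l0) ler_norml; apply/andP; split; lra.
Qed.

Lemma harc_tame (sigma tau : 'rV[R]_m) (kappa M : R) (a l c : R) w (s s' : R) : s <= s' ->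
  (c = 0 \/ a <= s /\ s' <= a + l) ->
  (forall j, `|tau 0 j - sigma 0 j| + `|c| * `|l| <= kappa) ->
  `|tau 0 q| + `|c| * `|l| <= M ->
  tame n_gt0 sigma kappa M (harc a l c w tau) s s'.
Proof.
move=> ss' cl tk tM; split=> // [j|]; last first.
  apply: le_trans (hdef_harc_bound _ _ ss' cl) _.
  by rewrite ler_wpM2r// sqr_ge0.
have d0 : 0 <= s' - s by rewrite subr_ge0.
rewrite !harc1E.
have -> : w.1 0 j + (s' - a) * tau 0 j + c * (s' - a) * (l - (s' - a)) * (j == q)%:R
   - (w.1 0 j + (s - a) * tau 0 j + c * (s - a) * (l - (s - a)) * (j == q)%:R)
   - sigma 0 j * (s' - s)
   = (tau 0 j - sigma 0 j) * (s' - s)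
     + c * (l - (s - a) - (s' - a)) * (s' - s) * (j == q)%:R by ring.
apply: le_trans (ler_normD _ _) _.
apply: (@le_trans _ _ ((`|tau 0 j - sigma 0 j| + `|c| * `|l|) * (s' - s)));
  last by rewrite ler_wpM2r.
rewrite [leRHS]mulrDl lerD//; first by rewrite normrM (ger0_norm d0).
rewrite normrM; apply: (@le_trans _ _ (`|c * (l - (s - a) - (s' - a)) * (s' - s)|)).
  by rewrite ler_piMr//; case: (j == q); rewrite ?normr1 ?normr0.
rewrite normrM (ger0_norm d0) ler_wpM2r//.
case: cl => [->|[as_ sl]]; first by rewrite mul0r normr0 mul0r.
rewrite normrM ler_wpM2l//.
have l0 : 0 <= l by lra.
by rewrite (ger0_norm l0) ler_norml; apply/andP; split; lra.
Qed.

End Comparison.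

(** * Interpolation along a tree *)

Section DyadicOrder.
Variable R : realType.

Definition dright (Q : dyadic) : R := dleft R Q + dlen R Q.

Lemma dintE Q s : dint R Q s <-> dleft R Q <= s < dright Q.
Proof. by rewrite /dint /dright /dleft /= in_itv/= intrD mulrDl mul1r. Qed.

Lemma dleft_in Q : dint R Q (dleft R Q).
Proof. by apply/dintE; rewrite lexx /dright ltrDl dlen_gt0. Qed.

Lemma ancestor_ends Q Q' : ancestor Q Q' ->
  dleft R Q' <= dleft R Q /\ dright Q <= dright Q'.
Proof.
by move=> /(dsubP R)/dsub_ends; rewrite /dright /dleft !intrD !mulrDl !mul1r.
Qed.

Lemma dint_nested Q Q' s : dint R Q s -> dint R Q' s -> ancestor Q Q' \/ ancestor Q' Q.
Proof.
wlog QQ' : Q Q' / Q.1 <= Q'.1 => [h|Qs Q's].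
  by case: (leP Q.1 Q'.1) => [|/ltW] le s1 s2; [exact: h|rewrite orC; exact: h].
left; pose i := `|Q'.1 - Q.1|%N; exists i.
have e1 : (iter i dpar Q).1 = Q'.1 by rewrite iter_dpar_scale /i; lia.
have : dint R (iter i dpar Q) s by apply: (iffRL (dsubP R Q _)) Qs; exists i.
case: (iter i dpar Q) e1 => j k /= ->; case: Q' Q's {i QQ'} => j' k' /=.
have l0 : 0 < (2 : R) ^ j' by rewrite exprz_gt0.
rewrite /dint /dlen /= !in_itv/= => /andP[a1 a2] /andP[b1 b2].
have := le_lt_trans a1 b2; have := le_lt_trans b1 a2.
by rewrite !ltr_pM2r// !ltr_int => ? ?; congr pair; lia.
Qed.

Lemma dint_child Q s : dint R Q s -> dint R (dchildl Q) s \/ dint R (dchildr Q) s.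
Proof. by rewrite {1}dchild_partition. Qed.

Lemma ancestor_child Q Q' : ancestor Q Q' -> Q <> Q' ->
  exists2 P, ancestor Q P & dpar P = Q'.
Proof. by move=> [[|i] <-] // _; exists (iter i dpar Q) => //; exists i. Qed.

End DyadicOrder.

Section TreeInterpolation.
Variables (R : realType) (T : set dyadic) (top : dyadic).
Hypothesis T_top : T top.
Hypothesis T_sub : forall Q, T Q -> ancestor Q top.
Hypothesis T_between : forall Q Q', T Q -> ancestor Q Q' -> ancestor Q' top -> T Q'.
Hypothesis T_children : forall Q, T Q -> (T (dchildl Q) <-> T (dchildr Q)).

(** By the two-children rule for trees, an interval without its left child in T has no
    child in T. *)
Definition minimal (Q : dyadic) : Prop := T Q /\ ~ T (dchildl Q).

Lemma minimal_eq Q Q' : T Q -> minimal Q' -> ancestor Q Q' -> Q = Q'.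
Proof.
move=> TQ [TQ' nl] QQ'; apply: contrapT => /(ancestor_child QQ')[P QP PQ'].
have TP : T P.
  apply: T_between TQ QP _; apply: ancestor_trans (ancestor_par P) _.
  by rewrite PQ'; exact: T_sub.
by case: (dpar_cases P); rewrite PQ' => eP; rewrite eP in TP; apply: nl => //; apply/T_children.
Qed.

Lemma minimal_uniq Q Q' s : minimal Q -> minimal Q' -> dint R Q s -> dint R Q' s -> Q = Q'.
Proof.
move=> mQ mQ' Qs Q's; case: (dint_nested Qs Q's) => h.
  by apply: minimal_eq h => //; case: mQ.
by apply/esym/minimal_eq => //; case: mQ'.
Qed.

(** These are the endpoints of the tree intervals and the points contained in
    arbitrarily short ones. *)
Definition skeleton : set R := [set s | dleft R top <= s <= dright R top /\
  forall Q, minimal Q -> ~ (dleft R Q < s < dright R Q)].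

Lemma tree_range Q : T Q -> dleft R top <= dleft R Q /\ dright R Q <= dright R top.
Proof. by move=> /T_sub/(ancestor_ends R). Qed.

Lemma skeleton_left Q : T Q -> skeleton (dleft R Q).
Proof.
move=> TQ; have [h1 h2] := tree_range TQ.
have l0 := dlen_gt0 R Q; split.
  by rewrite h1; apply: le_trans h2; rewrite lerDl ltW.
move=> Q' mQ' /andP[a b].
have Q'a : dint R Q' (dleft R Q) by apply/dintE; rewrite (ltW a) b.
case: (dint_nested (dleft_in R Q) Q'a) => [/(minimal_eq TQ mQ') e|/(ancestor_ends R)[e _]].
  by rewrite e ltxx in a.
by have := le_lt_trans e a; rewrite ltxx.
Qed.

Lemma skeleton_right Q : T Q -> skeleton (dright R Q).
Proof.
move=> TQ; have [h1 h2] := tree_range TQ.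
have l0 := dlen_gt0 R Q; split.
  by rewrite h2 andbT; apply: (le_trans h1); rewrite lerDl ltW.
move=> Q' mQ' /andP[a b].
have l0' := dlen_gt0 R Q'.
(* The larger left end is a common point of Q and Q', which are thus nested. *)
have Qx : dint R Q (Num.max (dleft R Q) (dleft R Q')).
  by apply/dintE; rewrite le_max lexx gt_max a andbT /= /dright ltrDl.
have Q'x : dint R Q' (Num.max (dleft R Q) (dleft R Q')).
  apply/dintE; rewrite le_max lexx orbT gt_max /= {2}/dright ltrDl l0' andbT.
  by apply: lt_trans b; rewrite /dright ltrDl.
case: (dint_nested Qx Q'x) => [/(minimal_eq TQ mQ') e|/(ancestor_ends R)[_ e]].
  by rewrite e ltxx in b.
by have := le_lt_trans e b; rewrite ltxx.
Qed.

Lemma skeleton_minimal Q s : skeleton s -> minimal Q -> dint R Q s -> s = dleft R Q.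
Proof.
move=> [_ h] mQ /dintE/andP[a b]; apply/eqP; rewrite eq_le a andbT leNgt.
by apply/negP => lt; apply: (h _ mQ); rewrite lt b.
Qed.

(** Descend from the top through the tree intervals containing s. The descent cannot
    end at an interval longer than 2 (s' - s): a minimal one would have s as its left end
    and s' in its interior. *)
Lemma skeleton_scale s s' : skeleton s -> skeleton s' -> s < s' ->
  exists Q, [/\ T Q, dint R Q s & s' - s <= dlen R Q <= 2 * (s' - s)].
Proof.
move=> Es Es' ss'; have [/andP[s1 _] _] := Es; have [/andP[_ s2] _] := Es'.
have d0 : 0 < s' - s by rewrite subr_gt0.
pose k := (Num.truncn (dlen R top / (s' - s))).+1.
have : dlen R top <= 2 ^+ k * (2 * (s' - s)).
  have : dlen R top <= 2 ^+ k * (s' - s).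
    rewrite -ler_pdivrMr//; apply: le_trans (ltW (Num.Theory.truncnS_gt _)) _.
    by rewrite -natrX ler_nat ltnW// ltn_expl.
  have : 0 <= 2 ^+ k * (s' - s) by rewrite mulr_ge0 ?exprn_ge0 ?(ltW d0).
  lra.
have : dint R top s by apply/dintE; rewrite s1 (lt_le_trans ss' s2).
have : s' - s <= dlen R top by move: s2; rewrite /dright; lra.
move: T_top; elim: k (top) => [|k IH] Q TQ sQ Qs bnd.
  by exists Q; split=> //; rewrite sQ; move: bnd; rewrite expr0 mul1r.
have [small|big] := leP (dlen R Q) (2 * (s' - s)); first by exists Q; rewrite sQ small.
have TlQ : T (dchildl Q).
  apply: contrapT => nl; have mQ : minimal Q by split.
  have e := skeleton_minimal Es mQ Qs; have [_ /(_ Q mQ)] := Es'; apply.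
  by rewrite /dright -e; apply/andP; split; lra.
have TrQ : T (dchildr Q) by apply/T_children.
have half : dlen R Q / 2 <= 2 ^+ k * (2 * (s' - s)).
  by move: bnd; rewrite exprS; lra.
case: (dint_child Qs) => Qs'; [apply: (IH (dchildl Q))|apply: (IH (dchildr Q))] => //;
  rewrite ?dlen_childl ?dlen_childr//; lra.
Qed.

Variables (n : nat) (n_gt0 : (0 < n)%N).
Local Notation m := (n + n).-1.
Local Notation q := (conj_coord n_gt0).
Local Notation hdef := (horizontal_defect n_gt0).
Variables (phi : R -> vert R n) (N e : R) (sigma : 'rV[R]_m).
Hypotheses (N_ge0 : 0 <= N) (e_ge0 : 0 <= e).
Hypothesis phi_lip : forall j s s', `|(phi s).1 0 j - (phi s').1 0 j| <= N * `|s - s'|.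
Hypothesis phi_hdef : forall s s', `|hdef phi s s'| <= N ^+ 2 * (s' - s) ^+ 2.
Hypothesis sigma_le : forall j, `|sigma 0 j| <= N.
Hypothesis phi_flat : forall Q, T Q -> forall j (s : R),
  dleft R Q - dlen R Q <= s <= dleft R Q + 2 * dlen R Q ->
  `|(phi s).1 0 j - (phi (dleft R Q)).1 0 j - sigma 0 j * (s - dleft R Q)| <= e * dlen R Q.

(** The Lipschitz constant allowed for the deviation of the approximating map from its
    linear part: 4 e from the skeleton and 12 e (1 + 2 n N) from the bumps. *)
Definition tilt : R := 16 * e + 24 * n%:R * e * N.
Definition lip_bound : R := N + tilt.
Definition defect_bound : R := 2 * lip_bound + n%:R * lip_bound ^+ 2 + N ^+ 2.
Local Notation tame := (tame n_gt0 sigma tilt defect_bound).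

Lemma tilt_ge0 : 0 <= tilt.
Proof. by rewrite /tilt addr_ge0 ?mulr_ge0. Qed.

Lemma lip_bound_ge0 : 0 <= lip_bound.
Proof. by rewrite /lip_bound addr_ge0 ?tilt_ge0. Qed.

Lemma lip_bound_sigma j : `|sigma 0 j| + tilt <= lip_bound.
Proof. by rewrite lerD2r. Qed.

Lemma defect_bound_large : lip_bound + n%:R * lip_bound ^+ 2 <= defect_bound.
Proof. by have := lip_bound_ge0; have := sqr_ge0 N; rewrite /defect_bound; lra. Qed.

Lemma defect_bound_lip : lip_bound <= defect_bound.
Proof.
apply: le_trans defect_bound_large; rewrite lerDl mulr_ge0 ?sqr_ge0//.
Qed.

Lemma defect_bound_N : N ^+ 2 <= defect_bound.
Proof.
have := lip_bound_ge0; have : 0 <= n%:R * lip_bound ^+ 2 by rewrite mulr_ge0 ?sqr_ge0.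
by rewrite /defect_bound; lra.
Qed.

Lemma tame_refl (f : R -> vert R n) s : tame f s s.
Proof.
split=> // [j|]; first by rewrite !subrr !mulr0 subrr normr0.
by rewrite /horizontal_defect omega_self !subrr mul0r mulr0 addr0 subr0 normr0 expr0n mulr0.
Qed.

Lemma tame_ext (f g : R -> vert R n) s s' :
  f s = g s -> f s' = g s' -> tame f s s' -> tame g s s'.
Proof. by move=> h1 h2 [? ? ?]; split; rewrite /horizontal_defect -?h1 -?h2. Qed.

(** Skeleton points lie in a tree interval of length comparable to their distance, and
    there phi follows the line of slope sigma. *)
Lemma tame_skeleton s s' : skeleton s -> skeleton s' -> s < s' -> tame phi s s'.
Proof.
move=> Es Es' ss'; split; first exact: ltW.
  move=> j; have [Q [TQ /dintE/andP[h1 h2] /andP[h3 h4]]] := skeleton_scale Es Es' ss'.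
  have l0 := dlen_gt0 R Q; rewrite /dright in h2.
  have i1 : dleft R Q - dlen R Q <= s <= dleft R Q + 2 * dlen R Q by apply/andP; split; lra.
  have i2 : dleft R Q - dlen R Q <= s' <= dleft R Q + 2 * dlen R Q by apply/andP; split; lra.
  have f1 := phi_flat TQ j i1; have f2 := phi_flat TQ j i2.
  have -> : (phi s').1 0 j - (phi s).1 0 j - sigma 0 j * (s' - s) =
    ((phi s').1 0 j - (phi (dleft R Q)).1 0 j - sigma 0 j * (s' - dleft R Q))
    - ((phi s).1 0 j - (phi (dleft R Q)).1 0 j - sigma 0 j * (s - dleft R Q)) by ring.
  apply: le_trans (ler_normB _ _) _.
  have : e * dlen R Q <= e * (2 * (s' - s)) by rewrite ler_wpM2l.
  have : 0 <= (12 * e + 24 * n%:R * e * N) * (s' - s).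
    apply: mulr_ge0; last by rewrite subr_ge0 ltW.
    by rewrite addr_ge0 ?mulr_ge0.
  rewrite /tilt; lra.
apply: le_trans (phi_hdef s s') _; rewrite ler_wpM2r ?sqr_ge0//; exact: defect_bound_N.
Qed.

Definition chord (Q : dyadic) : 'rV[R]_m :=
  (dlen R Q)^-1 *: ((phi (dright R Q)).1 - (phi (dleft R Q)).1).

(** The height for which fill reaches phi at the right end of Q. The parabola has
    integral bump Q |Q| ^ 3 / 6, to be matched with the horizontal defect left by the
    chord. *)
Definition bump (Q : dyadic) : R :=
  - 6 * (hdef phi (dleft R Q) (dright R Q) + 2^-1 * chord Q 0 q * dlen R Q ^+ 2) / dlen R Q ^+ 3.

Definition fill (Q : dyadic) : R -> vert R n :=
  harc n_gt0 (dleft R Q) (dlen R Q) (bump Q) (phi (dleft R Q)) (chord Q).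

Lemma chordE Q j : chord Q 0 j = ((phi (dright R Q)).1 0 j - (phi (dleft R Q)).1 0 j) / dlen R Q.
Proof. by rewrite !mxE mulrC. Qed.

Lemma chord_le Q j : `|chord Q 0 j| <= N.
Proof.
have l0 := dlen_gt0 R Q.
rewrite chordE normrM normfV (gtr0_norm l0) ler_pdivrMr//.
by apply: le_trans (phi_lip _ _ _) _; rewrite /dright addrAC subrr add0r gtr0_norm.
Qed.

Lemma chord_sigma Q j : T Q -> `|chord Q 0 j - sigma 0 j| <= e.
Proof.
move=> TQ; have l0 := dlen_gt0 R Q.
have i1 : dleft R Q - dlen R Q <= dright R Q <= dleft R Q + 2 * dlen R Q.
  by rewrite /dright; apply/andP; split; lra.
have := phi_flat TQ j i1; rewrite -ler_pdivrMr// -{1}(gtr0_norm l0) -normfV -normrM.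
have -> // : ((phi (dright R Q)).1 0 j - (phi (dleft R Q)).1 0 j -
     sigma 0 j * (dright R Q - dleft R Q)) / dlen R Q = chord Q 0 j - sigma 0 j.
by rewrite chordE /dright; field; rewrite lt0r_neq0.
Qed.

Lemma fill_left Q : fill Q (dleft R Q) = phi (dleft R Q).
Proof. exact: harc_start. Qed.

Lemma fill_right Q : fill Q (dright R Q) = phi (dright R Q).
Proof.
have l0 : dlen R Q != 0 by rewrite lt0r_neq0 ?dlen_gt0.
have da : dright R Q - dleft R Q = dlen R Q by rewrite /dright; ring.
have e1 : (fill Q (dright R Q)).1 = (phi (dright R Q)).1.
  apply/rowP => j; rewrite harc1E da chordE; field; exact: l0.
have := hdef_harc n_gt0 (dleft R Q) (dlen R Q) (bump Q) (phi (dleft R Q)) (chord Q)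
  (dleft R Q) (dright R Q).
rewrite -/(fill Q) {1}/horizontal_defect e1 fill_left da /bump.
have -> : hdef phi (dleft R Q) (dright R Q) =
  (phi (dright R Q)).2 - (phi (dleft R Q)).2 + dlen R Q * (phi (dleft R Q)).1 0 q
   - 2^-1 * omega (phi (dleft R Q)).1 (phi (dright R Q)).1 by rewrite /horizontal_defect da.
move=> h; rewrite [LHS]surjective_pairing [RHS]surjective_pairing e1; congr pair.
move: h; set c := chord Q 0 q; set l := dlen R Q; set x := omega _ _; rewrite subrr mulr0 subr0.
set t := (fill Q _).2; set t0 := (phi (dleft R Q)).2; set t1 := (phi _).2.
set y0 := (phi _).1 _ _.
have -> : l * l ^+ 2 / 2 - l ^+ 3 / 3 = l ^+ 3 / 6 by field.
rewrite mulNr -mulNr -/l.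
have -> : - (- 6 * (t1 - t0 + l * y0 - 2^-1 * x + 2^-1 * c * l ^+ 2) / l ^+ 3 * (l ^+ 3 / 6))
   = (t1 - t0 + l * y0 - 2^-1 * x + 2^-1 * c * l ^+ 2) by field.
lra.
Qed.

(** The chord and phi start together and stay 2 e |Q|-close over Q, so by vdiff_drift
    they end O(e N |Q| ^ 2) apart in the last coordinate. This mismatch fixes the bump,
    whose slope is thus O(e N). *)
Lemma bump_le Q : T Q -> `|bump Q| * dlen R Q <= 12 * e * (1 + 2 * n%:R * N).
Proof.
move=> TQ; have l0 := dlen_gt0 R Q.
have da : dright R Q - dleft R Q = dlen R Q by rewrite /dright; ring.
have ab : dleft R Q <= dright R Q by rewrite -subr_ge0 da ltW.
pose line := harc n_gt0 (dleft R Q) (dlen R Q) 0 (phi (dleft R Q)) (chord Q).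
have line1 s j : (line s).1 0 j = (phi (dleft R Q)).1 0 j + (s - dleft R Q) * chord Q 0 j.
  by rewrite harc1E !mul0r addr0.
have N1 : 0 <= N ^+ 2 + N by rewrite addr_ge0 ?sqr_ge0.
have := @vdiff_drift _ _ n_gt0 phi line N (N ^+ 2 + N) (2 * e * dlen R Q) _ _ ab N_ge0 N1.
have -> : vdiff (phi (dleft R Q)) (line (dleft R Q)) = 0.
  by rewrite /line harc_start /vdiff omega_self subrr mulr0 subr0.
have e1 : (line (dright R Q)).1 = (phi (dright R Q)).1.
  apply/rowP => j; rewrite line1 da chordE; field; exact: lt0r_neq0.
have -> : vdiff (phi (dright R Q)) (line (dright R Q)) =
    hdef phi (dleft R Q) (dright R Q) + 2^-1 * chord Q 0 q * dlen R Q ^+ 2.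
  have := hdef_harc n_gt0 (dleft R Q) (dlen R Q) 0 (phi (dleft R Q)) (chord Q)
    (dleft R Q) (dright R Q).
  rewrite -/line /vdiff /horizontal_defect e1 omega_self /line harc_start -/line da.
  rewrite mul0r subr0 mulr0.
  lra.
rewrite subr0 da => H.
have {}H : `|hdef phi (dleft R Q) (dright R Q) + 2^-1 * chord Q 0 q * dlen R Q ^+ 2|
   <= 2 * e * dlen R Q * (1 + 2 * n%:R * N) * dlen R Q.
  apply: le_trans (H _ _ _ _ _ _) _.
  - by rewrite !mulr_ge0 ?(ltW l0).
  - by move=> s s' j _ ss' _; apply: le_trans (phi_lip _ _ _) _; rewrite ger0_norm ?subr_ge0.
  - move=> s s' j _ ss' _; rewrite !line1.
    have -> : (phi (dleft R Q)).1 0 j + (s' - dleft R Q) * chord Q 0 j -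
      ((phi (dleft R Q)).1 0 j + (s - dleft R Q) * chord Q 0 j) = chord Q 0 j * (s' - s) by ring.
    by rewrite normrM (@ger0_norm _ (s' - s)) ?subr_ge0// ler_wpM2r ?subr_ge0 ?chord_le.
  - move=> s s' _ _ _; apply: le_trans (phi_hdef _ _) _.
    by rewrite ler_wpM2r ?sqr_ge0// lerDl.
  - move=> s s' as_ ss' s'b; apply: le_trans (hdef_harc_bound _ _ _ ss' (or_introl erefl)) _.
    rewrite normr0 mul0r addr0 ler_wpM2r ?sqr_ge0//; apply: le_trans (chord_le _ _) _.
    by rewrite lerDr sqr_ge0.
  - move=> s j as_ sb; rewrite line1.
    have i1 : dleft R Q - dlen R Q <= s <= dleft R Q + 2 * dlen R Q.
      by move: sb; rewrite /dright => sb; apply/andP; split; lra.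
    have f1 := phi_flat TQ j i1.
    have -> : (phi s).1 0 j - ((phi (dleft R Q)).1 0 j + (s - dleft R Q) * chord Q 0 j) =
      ((phi s).1 0 j - (phi (dleft R Q)).1 0 j - sigma 0 j * (s - dleft R Q))
      - (chord Q 0 j - sigma 0 j) * (s - dleft R Q) by ring.
    apply: le_trans (ler_normB _ _) _.
    have : `|(chord Q 0 j - sigma 0 j) * (s - dleft R Q)| <= e * dlen R Q.
      rewrite normrM; apply: ler_pM => //; first exact: chord_sigma.
      by rewrite ger0_norm ?subr_ge0//; move: sb; rewrite /dright; lra.
    lra.
  - by rewrite le_eqVlt; apply/orP; left; apply/eqP; ring.
rewrite /bump !normrM normfV (gtr0_norm (exprn_gt0 3 l0)) normrN (@ger0_norm _ 6)//.
set X := `|_ + _| in H *.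
have -> : 6 * X / dlen R Q ^+ 3 * dlen R Q = 6 * X / dlen R Q ^+ 2 by field; rewrite lt0r_neq0.
rewrite ler_pdivrMr ?exprn_gt0//; apply: le_trans (ler_wpM2l _ H) _ => //.
by rewrite le_eqVlt; apply/orP; left; apply/eqP; ring.
Qed.

Lemma fill_tame Q s s' : T Q -> dleft R Q <= s -> s <= s' -> s' <= dright R Q ->
  tame (fill Q) s s'.
Proof.
move=> TQ as_ ss' s'b; have l0 := dlen_gt0 R Q; have b := bump_le TQ.
apply: harc_tame => //; first by right.
  move=> j; rewrite (gtr0_norm l0); apply: le_trans (lerD (chord_sigma j TQ) b) _.
  by rewrite /tilt; have := e_ge0; lra.
rewrite (gtr0_norm l0); apply: le_trans (lerD (chord_le Q q) b) _.
apply: le_trans defect_bound_lip; rewrite /lip_bound lerD2l /tilt; have := e_ge0; lra.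
Qed.

(** Outside the top interval the approximating curve continues as a horizontal line. *)
Definition ray (a : R) : R -> vert R n := harc n_gt0 a 0 0 (phi a) sigma.

Lemma ray_tame a s s' : s <= s' -> tame (ray a) s s'.
Proof.
move=> ss'; apply: harc_tame => //; first by left.
  by move=> j; rewrite subrr !normr0 mul0r addr0 tilt_ge0.
rewrite !normr0 mul0r addr0; apply: le_trans defect_bound_lip.
by apply: le_trans (lip_bound_sigma q); rewrite lerDl tilt_ge0.
Qed.

Definition gap (s : R) (Q : dyadic) : Prop := minimal Q /\ dint R Q s.

(** phi on the skeleton, a corrected chord across every minimal interval, and
    horizontal lines outside the top interval. The default top of xget is discarded by
    the test that follows. *)
Definition tree_map (s : R) : vert R n :=
  if s < dleft R top then ray (dleft R top) s
  else if dright R top <= s then ray (dright R top) s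
  else let Q := xget top [set Q | gap s Q] in
       if `[< gap s Q >] then fill Q s else phi s.

Lemma tree_map_gap Q s : minimal Q -> dint R Q s -> tree_map s = fill Q s.
Proof.
move=> mQ Qs; have [h1 h2] := tree_range (proj1 mQ).
have /dintE/andP[h3 h4] := Qs.
rewrite /tree_map ltNge (le_trans h1 h3)/= leNgt (lt_le_trans h4 h2)/=.
have gQ : gap s Q by split.
case: xgetP => [Q' _ /= gQ'|/(_ Q)//].
rewrite asboolT//; case: gQ' => mQ' Q's.
by rewrite (minimal_uniq mQ' mQ Q's Qs).
Qed.

Lemma tree_map_skeleton s : skeleton s -> tree_map s = phi s.
Proof.
move=> Es; have [/andP[s1 s2] _] := Es.
have [[Q [mQ Qs]]|none] := pselect (exists Q, gap s Q).
  by rewrite (tree_map_gap mQ Qs) (skeleton_minimal Es mQ Qs) fill_left.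
rewrite /tree_map ltNge s1/=; case: ifPn => [h|h].
  have -> : s = dright R top by apply/eqP; rewrite eq_le s2 h.
  exact: harc_start.
by rewrite asboolF// => g; apply: none; exists (xget top [set Q | gap s Q]).
Qed.

Lemma skeleton_top_left : skeleton (dleft R top).
Proof. exact: skeleton_left. Qed.

Lemma skeleton_top_right : skeleton (dright R top).
Proof. exact: skeleton_right. Qed.

Lemma tree_map_closed_gap Q s : minimal Q -> dleft R Q <= s <= dright R Q ->
  tree_map s = fill Q s.
Proof.
move=> mQ /andP[a]; rewrite le_eqVlt => /orP[/eqP ->|b].
  rewrite fill_right; apply: tree_map_skeleton; apply: skeleton_right; exact: (proj1 mQ).
by apply: tree_map_gap => //; apply/dintE; rewrite a b.
Qed.

Lemma tree_map_left s : s <= dleft R top -> tree_map s = ray (dleft R top) s.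
Proof.
rewrite le_eqVlt => /orP[/eqP ->|h]; last by rewrite /tree_map h.
by rewrite (tree_map_skeleton skeleton_top_left) /ray harc_start.
Qed.

Lemma tree_map_right s : dright R top <= s -> tree_map s = ray (dright R top) s.
Proof.
move=> h; rewrite /tree_map h ltNge.
have [h1 h2] := tree_range T_top; have l0 := dlen_gt0 R top.
by rewrite (le_trans _ h) ?[X in _ <= X]/dright ?lerDl ?(ltW l0).
Qed.

(** A forward move either stays in one piece or meets the skeleton at the end of the
    piece it starts in. *)
Lemma tame_to_skeleton s s' : s <= s' -> tame tree_map s s' \/
  exists e', [/\ skeleton e', s <= e' <= s' & tame tree_map s e'].
Proof.
move=> ss'; have [h|h] := ltP s (dleft R top).
  have [h'|h'] := leP s' (dleft R top).
    left; apply: tame_ext (ray_tame (dleft R top) ss'); by rewrite tree_map_left// ltW.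
  right; exists (dleft R top); rewrite (ltW h) (ltW h').
  split=> //; first exact: skeleton_top_left.
  apply: tame_ext (ray_tame (dleft R top) (ltW h)); by rewrite tree_map_left// ltW.
have [h'|h'] := leP (dright R top) s.
  left; apply: tame_ext (ray_tame (dright R top) ss'); rewrite tree_map_right//.
  exact: le_trans ss'.
have [[Q [mQ Qs]]|none] := pselect (exists Q, gap s Q).
  have /dintE/andP[a b] := Qs; have TQ := proj1 mQ.
  have [c|c] := leP s' (dright R Q).
    left; apply: tame_ext (fill_tame TQ a ss' c).
      by rewrite (tree_map_closed_gap mQ)// a ltW.
    by rewrite (tree_map_closed_gap mQ)// c (le_trans a ss').
  right; exists (dright R Q); rewrite (ltW b) (ltW c); split=> //; first exact: skeleton_right.
  apply: tame_ext (fill_tame TQ a (ltW b) (lexx _)).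
    by rewrite (tree_map_closed_gap mQ)// a ltW.
  by rewrite (tree_map_closed_gap mQ)// lexx andbT (le_trans a (ltW b)).
right; exists s; rewrite lexx ss'; split=> //; last exact: tame_refl.
split; first by rewrite h ltW.
by move=> Q mQ /andP[a b]; apply: none; exists Q; split=> //; apply/dintE; rewrite (ltW a) b.
Qed.

Lemma tame_from_skeleton s s' : skeleton s -> s <= s' ->
  exists e', [/\ skeleton e', s <= e' <= s' & tame tree_map e' s'].
Proof.
move=> Es ss'; have [/andP[s1 s2] Es2] := Es.
have [h|h] := leP (dright R top) s'.
  exists (dright R top); rewrite s2 h; split=> //; first exact: skeleton_top_right.
  by apply: tame_ext (ray_tame (dright R top) h); rewrite tree_map_right.
have [[Q [mQ Qs]]|none] := pselect (exists Q, gap s' Q).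
  have /dintE/andP[a b] := Qs; have TQ := proj1 mQ.
  exists (dleft R Q); rewrite a andbT; split; first exact: skeleton_left.
    by rewrite leNgt; apply/negP => c; apply: (Es2 _ mQ); rewrite c (le_lt_trans ss' b).
  apply: tame_ext (fill_tame TQ (lexx _) a (ltW b)).
    by rewrite (tree_map_closed_gap mQ)// lexx (le_trans a (ltW b)).
  by rewrite (tree_map_closed_gap mQ)// a (ltW b).
exists s'; rewrite lexx ss'; split=> //; last exact: tame_refl.
split; first by rewrite (le_trans s1 ss') ltW.
by move=> Q mQ /andP[a b]; apply: none; exists Q; split=> //; apply/dintE; rewrite (ltW a) b.
Qed.

(** Three tame steps: to the skeleton, along the skeleton, and into the last piece. *)
Lemma tree_map_tame s s' : s <= s' -> tame tree_map s s'.
Proof.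
move=> ss'; case: (tame_to_skeleton ss') => // -[u [Eu /andP[su us'] tu]].
have [v [Ev /andP[uv vs'] tv]] := tame_from_skeleton Eu us'.
have chain := @tame_trans _ _ n_gt0 _ _ _ _ lip_bound_ge0 lip_bound_sigma defect_bound_large.
apply: (chain _ _ _ _ tu); apply: (chain _ _ _ _ _ tv).
move: uv; rewrite le_eqVlt => /orP[/eqP ->|uv]; first exact: tame_refl.
apply: tame_ext (tame_skeleton Eu Ev uv); by rewrite tree_map_skeleton.
Qed.

Lemma tree_map_intrinsic_lipschitz : intrinsic_lipschitz tree_map.
Proof.
apply: (tame_intrinsic_lipschitz lip_bound_ge0 lip_bound_sigma defect_bound_large) => s s' ss'.
exact/tree_map_tame/ltW.
Qed.

Lemma tree_map_slope j s s' :
  `|(tree_map s').1 0 j - (tree_map s).1 0 j - sigma 0 j * (s' - s)| <= tilt * `|s' - s|.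
Proof.
wlog ss' : s s' / s <= s' => [h|].
  case: (leP s s') => [/h//|/ltW/h H]; rewrite (distrC s') -[leLHS]normrN opprB.
  suff -> : sigma 0 j * (s' - s) - ((tree_map s').1 0 j - (tree_map s).1 0 j)
    = (tree_map s).1 0 j - (tree_map s').1 0 j - sigma 0 j * (s - s') by [].
  by ring.
by have [_ h _] := tree_map_tame ss'; rewrite (@ger0_norm _ (s' - s)) ?subr_ge0.
Qed.

(** Both curves start together at the left end of Q and deviate from the line of slope
    sigma by at most e |Q| and 3 / 2 tilt |Q|. *)
Lemma tree_map_near Q s j : T Q ->
  dleft R Q - dlen R Q / 2 <= s <= dleft R Q + 3 / 2 * dlen R Q ->
  `|(phi s).1 0 j - (tree_map s).1 0 j| <= 2 * tilt * dlen R Q.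
Proof.
move=> TQ /andP[s1 s2]; have l0 := dlen_gt0 R Q.
have i1 : dleft R Q - dlen R Q <= s <= dleft R Q + 2 * dlen R Q by apply/andP; split; lra.
have f1 := phi_flat TQ j i1; have f2 := tree_map_slope j (dleft R Q) s.
have e1 := tree_map_skeleton (skeleton_left TQ); rewrite e1 in f2.
have -> : (phi s).1 0 j - (tree_map s).1 0 j =
  ((phi s).1 0 j - (phi (dleft R Q)).1 0 j - sigma 0 j * (s - dleft R Q))
  - ((tree_map s).1 0 j - (phi (dleft R Q)).1 0 j - sigma 0 j * (s - dleft R Q)) by ring.
apply: le_trans (ler_normB _ _) _.
have : tilt * `|s - dleft R Q| <= tilt * (3 / 2 * dlen R Q).
  by rewrite ler_wpM2l ?tilt_ge0// ler_norml; apply/andP; split; lra.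
have : e * dlen R Q <= tilt * (dlen R Q / 2).
  have : 0 <= (7 * e + 12 * n%:R * e * N) * dlen R Q.
    by rewrite mulr_ge0 ?(ltW l0)// addr_ge0 ?mulr_ge0.
  by rewrite /tilt; lra.
lra.
Qed.

(** The left end of Q is on the skeleton, where both curves agree; vdiff_drift then
    integrates the closeness of the W-coordinates over a distance at most 3 / 2 |Q|. *)
Lemma tree_map_vdiff Q s : T Q ->
  dleft R Q - dlen R Q / 2 <= s <= dleft R Q + 3 / 2 * dlen R Q ->
  `|vdiff (phi s) (tree_map s)| <= 3 * tilt * (1 + 2 * n%:R * lip_bound) * dlen R Q ^+ 2.
Proof.
move=> TQ /andP[s1 s2]; have l0 := dlen_gt0 R Q.
have v0 : vdiff (phi (dleft R Q)) (tree_map (dleft R Q)) = 0.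
  rewrite (tree_map_skeleton (skeleton_left TQ)) /vdiff omega_self.
  by rewrite subrr mulr0 subr0.
have M0 : 0 <= defect_bound by apply: le_trans defect_bound_lip; exact: lip_bound_ge0.
have E0 : 0 <= 2 * tilt * dlen R Q by rewrite !mulr_ge0 ?tilt_ge0 ?(ltW l0).
have drift a b : a <= b -> dleft R Q - dlen R Q / 2 <= a -> b <= dleft R Q + 3 / 2 * dlen R Q ->
    `|vdiff (phi b) (tree_map b) - vdiff (phi a) (tree_map a)|
     <= (2 * tilt * dlen R Q + 2 * n%:R * (2 * tilt * dlen R Q) * lip_bound) * (b - a).
  move=> ab a1 b1; apply: (@vdiff_drift _ _ n_gt0 phi tree_map lip_bound defect_bound) => //.
  - exact: lip_bound_ge0.
  - move=> u v j _ uv _; apply: le_trans (phi_lip _ _ _) _.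
    rewrite ger0_norm ?subr_ge0// ler_wpM2r ?subr_ge0//.
    by rewrite /lip_bound lerDl tilt_ge0.
  - by move=> u v j _ uv _; apply: (tame_lip lip_bound_sigma); exact: tree_map_tame.
  - move=> u v _ _ _; apply: le_trans (phi_hdef _ _) _.
    by rewrite ler_wpM2r ?sqr_ge0// defect_bound_N.
  - by move=> u v _ uv _; have [_ _] := tree_map_tame uv.
  - by move=> u j au ub; apply: tree_map_near => //; rewrite (le_trans a1 au) (le_trans ub b1).
have c0 : 0 <= 2 * tilt * dlen R Q + 2 * n%:R * (2 * tilt * dlen R Q) * lip_bound.
  by rewrite addr_ge0// !mulr_ge0 ?lip_bound_ge0 ?tilt_ge0 ?(ltW l0).
have -> : 3 * tilt * (1 + 2 * n%:R * lip_bound) * dlen R Q ^+ 2 =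
  (2 * tilt * dlen R Q + 2 * n%:R * (2 * tilt * dlen R Q) * lip_bound)
  * (3 / 2 * dlen R Q) by field.
have [h|h] := leP (dleft R Q) s.
  have := drift _ _ h ltac:(lra) s2; rewrite v0 subr0 => H.
  by apply: le_trans H _; rewrite ler_wpM2l//; lra.
have := drift _ _ (ltW h) s1 ltac:(lra); rewrite v0 sub0r normrN => H.
by apply: le_trans H _; rewrite ler_wpM2l//; lra.
Qed.

End TreeInterpolation.

(** * Choice of constants and conclusion *)

Definition line_through (R : realType) (m : nat) (v : 'rV[R]_m) (s : R^o) : 'rV[R]_m :=
  (s : R) *: v.

Lemma line_through_linear (R : realType) (m : nat) (v : 'rV[R]_m) :
  linear (line_through v).
Proof. by move=> a s s'; rewrite /line_through scalerDl scalerA. Qed.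

HB.instance Definition _ (R : realType) (m : nat) (v : 'rV[R]_m) :=
  GRing.isLinear.Build R R^o 'rV[R]_m _ (line_through v) (line_through_linear v).

Lemma enormZ (R : realType) (m : nat) (a : R) (v : 'rV[R]_m) :
  enorm (a *: v) = `|a| * enorm v.
Proof.
rewrite /enorm -sqrtr_sqr -sqrtrM ?sqr_ge0// mulr_sumr.
by congr Num.sqrt; apply: eq_bigr => i _; rewrite mxE exprMn.
Qed.

Lemma line_through_lipschitz (R : realType) (m : nat) (v : 'rV[R]_m) (K : R) :
  enorm v <= K -> euclidean_lipschitz K (line_through v).
Proof.
by move=> vK s s'; rewrite /line_through -scalerBl enormZ mulrC ler_wpM2r.
Qed.

Lemma vert_dim_le (R : realType) (n : nat) : ((n + n).-1)%:R <= 2 * n%:R :> R.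
Proof. by rewrite -natrM ler_nat; lia. Qed.

(** With e = eps N one has tilt <= 40 n N ^ 2 eps, that is, at most
    eta ^ 2 N ^ 2 / (15 n). This is small enough for the W-coordinates, and, as the
    Lipschitz bound N + tilt is at most 2 N ^ 2, also for the last coordinate, where a
    square root is taken. *)
Lemma small_constants (R : realType) (n : nat) (eta N eps : R) :
  (0 < n)%N -> 0 < eta -> eta < 1 -> 1 <= N ->
  600 * n%:R ^+ 2 * eps = eta ^+ 2 ->
  let k := tilt n N (eps * N) in
  4 * n%:R * k <= eta * N ^+ 2 /\
  3 * k * (1 + 2 * n%:R * (N + k)) <= (eta * N ^+ 2) ^+ 2.
Proof.
move=> n0 e0 e1 N1 epsE.
have n1 : 1 <= n%:R :> R by rewrite ler1n.
set x : R := n%:R in n1 epsE *.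
have x0 : 0 < x by lra.
have N0 : 0 < N by lra.
set k := tilt _ _ _.
have kE : 600 * x ^+ 2 * k = eta ^+ 2 * N * (16 + 24 * x * N).
  by rewrite /k /tilt -/x -epsE; ring.
clearbody k x => {epsE}.
have xN : 1 <= x * N by nra.
have k1 : 15 * x * k <= eta ^+ 2 * N ^+ 2.
  have : 600 * x ^+ 2 * k <= eta ^+ 2 * N * (40 * (x * N)).
    by rewrite kE ler_wpM2l ?mulr_ge0 ?sqr_ge0 ?(ltW N0)//; lra.
  have -> : 600 * x ^+ 2 * k = (15 * x * k) * (40 * x) by ring.
  have -> : eta ^+ 2 * N * (40 * (x * N)) = (eta ^+ 2 * N ^+ 2) * (40 * x) by ring.
  by rewrite ler_pM2r ?mulr_gt0.
have k0 : 0 <= k.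
  have : 0 <= 600 * x ^+ 2 * k.
    rewrite kE; apply: mulr_ge0; last by lra.
    by rewrite mulr_ge0 ?sqr_ge0 ?(ltW N0).
  have c0 : 0 < 600 * x ^+ 2 by apply: mulr_gt0; [lra|rewrite exprn_gt0].
  by rewrite (pmulr_rge0 k c0).
have N2 : N <= N ^+ 2 by rewrite expr2 ler_peMl// ltW.
have eN : eta ^+ 2 * N ^+ 2 <= eta * N ^+ 2.
  by rewrite ler_wpM2r ?sqr_ge0// expr2 ger_pMl// ltW.
have xk : 0 <= x * k by rewrite mulr_ge0 ?(ltW x0).
split; first by lra.
have eN1 : eta * N ^+ 2 <= N ^+ 2 by rewrite ger_pMl ?exprn_gt0// ltW.
have kN : k <= N ^+ 2.
  have : k <= x * k by rewrite ler_peMl.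
  lra.
have c1 : 1 + 2 * x * (N + k) <= 5 * x * N ^+ 2.
  have : 2 * x * (N + k) <= 2 * x * (2 * N ^+ 2) by rewrite ler_wpM2l ?mulr_ge0 ?(ltW x0)//; lra.
  have : 1 <= x * N ^+ 2 by apply: le_trans xN _; rewrite ler_wpM2l ?(ltW x0).
  lra.
apply: (@le_trans _ _ (3 * k * (5 * x * N ^+ 2))).
  by rewrite ler_wpM2l ?mulr_ge0.
have -> : 3 * k * (5 * x * N ^+ 2) = 15 * x * k * N ^+ 2 by ring.
have -> : (eta * N ^+ 2) ^+ 2 = eta ^+ 2 * N ^+ 2 * N ^+ 2 by ring.
by rewrite ler_wpM2r ?sqr_ge0.
Qed.

Theorem corollary5p30 (R : realType) (n : nat) (n_gt1 : (1 < n)%N)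
    (eta : R) (eta_gt0 : 0 < eta) (eta_lt1 : eta < 1) :
  exists2 C : R, 1 <= C &
    forall (N : R) (phi : R -> vert R n),
      1 <= N -> intrinsic_lipschitz_with N phi ->
      exists (G B : set dyadic) (F : set (set dyadic)),
        coronization C G B F /\
        forall T : set dyadic, F T ->
          exists (phiT : R -> vert R n)
                 (L : {linear R^o -> 'rV[R]_(n + n).-1})
                 (psi : R -> 'rV[R]_(n + n).-1),
            [/\ intrinsic_lipschitz phiT,
                forall s, (phiT s).1 = L s + psi s,
                euclidean_lipschitz (2 * N ^+ 2) L,
                euclidean_lipschitz (eta * N ^+ 2) psi
              & forall (Q : dyadic) (s : R), T Q -> ddouble R Q s ->
                  hdist (of_W (phi s)) (of_W (phiT s))
                    <= eta * N ^+ 2 * dlen R Q].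
Proof.
have n_gt0 : (0 < n)%N := ltnW n_gt1.
have m_gt0 : (0 < (n + n).-1)%N by lia.
have [eps eps0 epsE] : exists2 eps : R, 0 < eps & 600 * n%:R ^+ 2 * eps = eta ^+ 2.
  have n2 : 0 < n%:R ^+ 2 :> R by rewrite exprn_gt0// ltr0n.
  exists (eta ^+ 2 / (n%:R ^+ 2) / 600); last by field; rewrite lt0r_neq0 ?ltr0n.
  by rewrite !divr_gt0 ?exprn_gt0 ?ltr0n.
have [C C1 corona] := @lipschitz_corona R 'I_(n + n).-1 eps eps0.
exists C => // N phi N1 lip.
have N0 : 0 < N by lra.
have coord := intrinsic_lipschitz_coord n_gt0 lip.
have hd s s' := intrinsic_lipschitz_hdef n_gt0 s s' (ltW N0) lip.
pose y (j : 'I_(n + n).-1) (s : R) := (phi s).1 0 j.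
have [G [B [F [cor close]]]] := corona N y N0 coord.
exists G, B, F; split => // T FT.
have treeT : is_tree R T by have [_ _ _ [h _ _ _]] := cor; exact: h.
have [T_top T_sub] := tree_topP treeT.
have [top [isT T_bet T_ch]] := treeT.
have topE : top = tree_top R T by apply: is_top_uniq isT (tree_topP treeT).
rewrite {}topE {isT} in T_bet.
set t := tree_top R T in T_top T_sub T_bet.
have sub Q : T Q -> ancestor Q t by move=> /T_sub/dsubP.
have bet Q Q' : T Q -> ancestor Q Q' -> ancestor Q' t -> T Q'.
  by move=> TQ /(dsubP R) h1 /(dsubP R) h2; exact: T_bet h1 h2.
pose sigma : 'rV[R]_(n + n).-1 := \row_j dslope y j t.
have sigmaE : sigma = (dlen R t)^-1 *: ((phi (dright R t)).1 - (phi (dleft R t)).1).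
  by apply/rowP => j; rewrite !mxE /dslope /slope mulrC.
have l0 := dlen_gt0 R t.
have sigmaN : enorm sigma <= N.
  rewrite sigmaE enormZ normfV (gtr0_norm l0) mulrC ler_pdivrMr//.
  have [+ _] := iffLR (intrinsic_lipschitz_withE n_gt0 N phi) lip (dleft R t) (dright R t).
  by rewrite /dright [_ + _ - _]addrAC subrr add0r (gtr0_norm l0).
have sigma_le j : `|sigma 0 j| <= N := le_trans (enorm_ge_coord _ _) sigmaN.
have flat Q : T Q -> forall j (s : R),
    dleft R Q - dlen R Q <= s <= dleft R Q + 2 * dlen R Q ->
    `|(phi s).1 0 j - (phi (dleft R Q)).1 0 j - sigma 0 j * (s - dleft R Q)|
      <= eps * N * dlen R Q.
  by move=> TQ j s sQ; rewrite mxE; exact: (close T FT Q TQ j s sQ).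
have e0 : 0 <= eps * N by rewrite mulr_ge0 ?ltW.
have [k1 k2] := small_constants n_gt0 eta_gt0 eta_lt1 N1 epsE.
set k := tilt _ _ _ in k1 k2.
have k0 : 0 <= k by apply: tilt_ge0 => //; exact: ltW.
pose phiT := tree_map T t n_gt0 phi sigma.
have mn := vert_dim_le R n.
have l0' := dlen_gt0 R.
exists phiT, (line_through sigma), (fun s => (phiT s).1 - line_through sigma s); split.
- by apply: (tree_map_intrinsic_lipschitz T_top sub bet T_ch (ltW N0) e0 coord hd sigma_le flat).
- by move=> s; rewrite addrC subrK.
- apply: line_through_lipschitz; apply: le_trans sigmaN _; nra.
- move=> s s'; apply: (@le_trans _ _ (((n + n).-1)%:R * (k * `|s - s'|))).
    apply: enorm_le => // j.
    have := tree_map_slope T_top sub bet T_ch (ltW N0) e0 coord hd sigma_le flat j s' s.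
    suff <- : ((phiT s).1 - line_through sigma s - ((phiT s').1 - line_through sigma s')) 0 j
      = (phiT s).1 0 j - (phiT s').1 0 j - sigma 0 j * (s - s') by [].
    by rewrite /line_through; move: (sigma) => v; rewrite !mxE; ring.
  rewrite mulrA ler_wpM2r//; apply: le_trans k1.
  rewrite ler_wpM2r//; have : 0 <= n%:R :> R by []; lra.
move=> Q s TQ; rewrite /ddouble /= in_itv/= => /andP[s1 s2].
have sQ : dleft R Q - dlen R Q / 2 <= s <= dleft R Q + 3 / 2 * dlen R Q.
  move: s1 s2; rewrite /dmid -/(dleft R Q) mulrDl -/(dleft R Q) => s1 s2.
  by apply/andP; split; lra.
have lQ := l0' Q.
have eN : 0 <= eta * N ^+ 2 by rewrite mulr_ge0 ?sqr_ge0// ltW.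
rewrite (hdist_of_W n_gt0) ge_max; apply/andP; split.
  apply: (@le_trans _ _ (((n + n).-1)%:R * (2 * k * dlen R Q))).
    apply: enorm_le => // j; rewrite !mxE.
    exact: (tree_map_near T_top sub bet T_ch (ltW N0) e0 coord hd sigma_le flat j TQ sQ).
  rewrite mulrA ler_wpM2r ?(ltW lQ)//; apply: le_trans k1.
  have : (n + n).-1%:R * k <= 2 * n%:R * k by rewrite ler_wpM2r.
  lra.
rewrite sqrt_le; last by apply: mulr_ge0; rewrite ?(ltW lQ).
apply: le_trans (tree_map_vdiff T_top sub bet T_ch (ltW N0) e0 coord hd sigma_le flat TQ sQ) _.
by rewrite [leRHS]exprMn ler_wpM2r ?sqr_ge0.
Qed.
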